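(* Let $\mathbb{F}_q$ be a finite field of characteristic $p$ and let $n$ be a positive integer with $p>n$. Let $\lambda$ be a partition of $n$ whose conjugate partition $\lambda'$ satisfies $\lambda\neq\lambda'$, and put $\gamma=\{\lambda,\lambda'\}$. Then $$e_\lambda:=e_\lambda^{S_n}+e_{\lambda'}^{S_n}$$ is a centrally primitive idempotent of $\mathbb{F}_qA_n$ (in particular it lies in $\mathbb{F}_qA_n$), and it generates the ideal $I_\gamma$, i.e. $I_\gamma=\mathbb{F}_qA_n\,e_\lambda$.
   Context: $S_n$ and $A_n$ are the symmetric and alternating groups; since $p>n$, both $\mathbb{F}_qS_n$ and $\mathbb{F}_qA_n$ are semisimple, and $\mathbb{F}_qA_n\subseteq\mathbb{F}_qS_n$. For a partition $\mu$ of $n$, $d_\mu$ is the number of standard Young tableaux of shape $\mu$. For a Young tableau $T$ of shape $\mu$ (a filling of the diagram of $\mu$ with the distinct numbers $1,\ldots,n$) with row stabilizer $R_T$ and column stabilizer $C_T$ in $S_n$, the element $e_T=\frac{d_\mu}{n!}\sum_{p\in R_T}\sum_{q\in C_T}\operatorname{sgn}(q)\,qp$ is a primitive idempotent of $\mathbb{F}_qS_n$. The Wedderburn–Artin decomposition is $\mathbb{F}_qS_n=\bigoplus_\mu J_\mu$ over partitions $\mu$ of $n$, where $J_\mu\cong M_{d_\mu}(\mathbb{F}_q)$ is the minimal two-sided ideal containing $e_T$ for all tableaux $T$ of shape $\mu$; $e_\mu^{S_n}$ denotes the identity element of $J_\mu$, a centrally primitive idempotent of $\mathbb{F}_qS_n$.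 When $\lambda\neq\lambda'$ (the conjugate, i.e. transposed, partition), the irreducible $\mathbb{F}_qS_n$-modules $\mathbb{F}_qS_ne_T$ for $T$ of shape $\lambda$ or $\lambda'$ restrict to one and the same (up to isomorphism) irreducible $\mathbb{F}_qA_n$-module, of dimension $d_\lambda$; $I_\gamma$, for $\gamma=\{\lambda,\lambda'\}$, is the minimal two-sided ideal (Wedderburn component) of $\mathbb{F}_qA_n$ corresponding to this module, and $I_\gamma\cong M_{d_\lambda}(\mathbb{F}_q)$. A centrally primitive idempotent is a nonzero central idempotent that is not a sum of two nonzero orthogonal central idempotents. *)

(* Defs.v *)
From HB Require Import structures.
From mathcomp Require Import all_boot all_order all_algebra all_fingroup.
From mathcomp Require Import all_solvable all_field.
From mathcomp Require classical_sets.

Set Implicit Arguments.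
Unset Strict Implicit.
Unset Printing Implicit Defensive.

Import GRing.Theory.
Local Open Scope ring_scope.

(* The product is convolution; an alias is needed because {ffun gT -> F} carries
   the pointwise product. *)
Definition galg (F : fieldType) (gT : finGroupType) := {ffun gT -> F}.

Section GroupAlgebra.
Variables (F : fieldType) (gT : finGroupType).
Local Notation A := (galg F gT).
Implicit Types (a b c : A) (g h : gT).

HB.instance Definition _ := Vector.copy A {ffun gT -> F^o}.

Definition galg_one : A := [ffun g => (g == 1%g)%:R].
Definition galg_mul a b : A := [ffun g => \sum_h a h * b (h^-1 * g)%g].

Fact galg_mulA : associative galg_mul.
Proof.
move=> a b c; apply/ffunP=> g; rewrite !ffunE.
under [LHS]eq_bigr => h _ do rewrite ffunE mulr_sumr.
under [RHS]eq_bigr => k _ do rewrite ffunE mulr_suml.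
rewrite [RHS]exchange_big /=; apply: eq_bigr => h _.
rewrite [RHS](reindex_inj (mulgI h)) /=; apply: eq_bigr => k _.
by rewrite mulKg invMg !mulgA mulrA.
Qed.

Fact galg_mul1 : left_id galg_one galg_mul.
Proof.
move=> a; apply/ffunP=> g; rewrite ffunE (bigD1 1%g) //= ffunE eqxx mul1r.
rewrite invg1 mul1g big1 ?addr0 // => h /negPf h1.
by rewrite ffunE h1 mul0r.
Qed.

Fact galg_mulr1 : right_id galg_one galg_mul.
Proof.
move=> a; apply/ffunP=> g; rewrite ffunE (bigD1 g) //= ffunE mulVg eqxx mulr1.
rewrite big1 ?addr0 // => h /negPf hg.
by rewrite ffunE -eq_mulVg1 hg mulr0.
Qed.

Fact galg_mulDl : left_distributive galg_mul +%R.
Proof.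
move=> a b c; apply/ffunP=> g; rewrite !ffunE -big_split /=.
by apply: eq_bigr => h _; rewrite ffunE mulrDl.
Qed.

Fact galg_mulDr : right_distributive galg_mul +%R.
Proof.
move=> a b c; apply/ffunP=> g; rewrite !ffunE -big_split /=.
by apply: eq_bigr => h _; rewrite ffunE mulrDr.
Qed.

Fact galg_oner_neq0 : galg_one != 0.
Proof.
by apply/eqP => /ffunP/(_ 1%g); rewrite !ffunE eqxx => /eqP; rewrite oner_eq0.
Qed.

HB.instance Definition _ := GRing.Zmodule_isNzRing.Build A
  galg_mulA galg_mul1 galg_mulr1 galg_mulDl galg_mulDr galg_oner_neq0.

Lemma galgZE (x : F) a g : (x *: a) g = x * a g.
Proof. by rewrite ffunE. Qed.

Lemma galgME a b g : (a * b) g = \sum_h a h * b (h^-1 * g)%g.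
Proof. by rewrite ffunE. Qed.

Fact galg_scaleAl (x : F) a b : x *: (a * b) = (x *: a) * b.
Proof.
apply/ffunP=> g; rewrite galgZE !galgME mulr_sumr.
by apply: eq_bigr => h _; rewrite galgZE mulrA.
Qed.

Fact galg_scaleAr (x : F) a b : x *: (a * b) = a * (x *: b).
Proof.
apply/ffunP=> g; rewrite galgZE !galgME mulr_sumr.
by apply: eq_bigr => h _; rewrite galgZE mulrCA.
Qed.

HB.instance Definition _ := GRing.Lmodule_isLalgebra.Build F A galg_scaleAl.
HB.instance Definition _ := GRing.Lalgebra_isAlgebra.Build F A galg_scaleAr.
HB.instance Definition _ := Algebra_isFalgebra.Build F A.

Definition gelt g : A := [ffun h => (h == g)%:R].

Lemma gelt1 : gelt 1%g = 1. Proof. by []. Qed.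

Lemma geltM g h : gelt (g * h)%g = gelt g * gelt h.
Proof.
apply/ffunP=> k; rewrite !ffunE (bigD1 g) //= !ffunE eqxx mul1r big1 => [|j jg].
  by rewrite addr0 -(inj_eq (mulgI g^-1)%g) mulKg.
by rewrite ffunE (negPf jg) mul0r.
Qed.

Definition gspan (G : {set gT}) : {vspace A} := <<[seq gelt g | g in G]>>%VS.

End GroupAlgebra.

(* In what follows B is the subspace underlying a unital subalgebra of aT. *)
Section Ideals.
Variables (F : fieldType) (aT : falgType F).
Implicit Types (B I J L M : {vspace aT}) (e f g : aT).

Definition left_ideal B L := (L <= B)%VS && (B * L <= L)%VS.

Definition ideal B I := [&& (I <= B)%VS, (B * I <= I)%VS & (I * B <= I)%VS].

Definition minimal_left_ideal B L :=
  [/\ left_ideal B L, L != 0%VS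
    & forall K, left_ideal B K -> (K <= L)%VS -> K != 0%VS -> K = L].

Definition minimal_ideal B I :=
  [/\ ideal B I, I != 0%VS
    & forall K, ideal B K -> (K <= I)%VS -> K != 0%VS -> K = I].

(* L and M, both stable under left multiplication by B, are isomorphic as left
   B-modules; every linear map on L extends to aT, hence f : 'End(aT). *)
Definition module_iso B L M := exists f : 'End(aT),
  [/\ {in L &, injective f}, (f @: L)%VS = M
    & {in B & L, forall b x, f (b * x) = b * f x}].

(* The Wedderburn component corresponding to the irreducible left B-module M:
   the minimal two-sided ideal whose minimal left ideals are exactly the minimal
   left ideals isomorphic to M. *)
Definition component_of B M I :=
  minimal_ideal B I
  /\ forall L, minimal_left_ideal B L -> (L <= I)%VS <-> module_iso B L M.

Definition central_idempotent B e := e \in 'Z(B)%VS /\ e * e = e.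

Definition centrally_primitive B e :=
  [/\ central_idempotent B e, e != 0
    & ~ exists f g,
        [/\ central_idempotent B f, central_idempotent B g, f != 0 & g != 0]
        /\ [/\ f * g = 0, g * f = 0 & e = f + g]].

End Ideals.

Definition is_partition n (s : seq nat) :=
  [&& sorted geq s, 0%N \notin s & sumn s == n].

Record intpart n :=
  IntPart { parts :> seq nat; partsP : is_partition n parts }.

HB.instance Definition _ n := [isSub for @parts n].
HB.instance Definition _ n := [Choice of intpart n by <:].

(* The j-th part of the conjugate is the length of the j-th column. *)
Definition conj_seq (s : seq nat) :=
  mkseq (fun j => count (fun x => j < x)%N s) (head 0%N s).

Lemma head_max s x : sorted geq s -> x \in s -> (x <= head 0 s)%N.
Proof.
case: s => //= y s; rewrite path_sortedE; last first.
  by move=> a b c ba cb; apply: leq_trans ba.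
by case/andP=> /allP y_max _; rewrite inE => /predU1P[-> // | /y_max].
Qed.

Fact conj_intpart_subproof n (mu : intpart n) :
  is_partition n (conj_seq mu).
Proof.
have /and3P[mu_sorted mu_pos /eqP sum_mu] := partsP mu.
apply/and3P; split.
- rewrite /conj_seq /mkseq sorted_map.
  apply: (@sub_sorted _ leq); last exact: iota_sorted.
  by move=> i j ij; apply: sub_count => x /=; apply: leq_ltn_trans.
- apply/mapP=> -[j]; rewrite mem_iota /= add0n => j_mu.
  case: (parts mu) j_mu => //= x s jx; by rewrite jx.
rewrite -{2}sum_mu sumnE /conj_seq /mkseq big_map sumnE.
under eq_bigr => j _ do rewrite -sum1_count big_mkcond.
rewrite exchange_big /= big_seq_cond [X in _ == X]big_seq_cond.
apply/eqP/eq_bigr => x; rewrite andbT => /(head_max mu_sorted) x_le.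
rewrite -big_mkcond sum1_count -(subnKC x_le) iotaD count_cat add0n.
rewrite -[RHS]addn0; congr (_ + _)%N.
  rewrite -[RHS](size_iota 0); apply/eqP; rewrite -all_count.
  by apply/allP=> j; rewrite mem_iota.
apply/eqP; rewrite -[_ == 0]negbK -lt0n -has_count; apply/hasPn=> j.
by rewrite mem_iota => /andP[xj _] /=; rewrite -leqNgt.
Qed.

Definition conj_intpart n (mu : intpart n) : intpart n :=
  IntPart (conj_intpart_subproof mu).

Lemma conj_intpartP n (mu : intpart n) i j :
  (j < nth 0 (conj_intpart mu) i = (i < nth 0 mu j))%N.
Proof.
have /and3P[+ _ _] := partsP mu.
rewrite [parts (conj_intpart mu)]/= /conj_seq.
case: (ltnP i (head 0%N mu)) => [i_mu | mu_i] mu_sorted; last first.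
  rewrite nth_default ?size_mkseq // ltn0; apply/esym/negbTE; rewrite -leqNgt.
  apply: leq_trans mu_i; have [j_mu | mu_j] := ltnP j (size mu).
    by rewrite (head_max mu_sorted) ?mem_nth.
  by rewrite nth_default.
rewrite nth_mkseq //; elim: (parts mu) mu_sorted j {i_mu} => [|x s IHs] xs j.
  by rewrite nth_nil.
have s_sorted := path_sorted xs; rewrite /=.
case: (ltnP i x) => [ix | xi]; first by case: j => [|j] //=; rewrite -IHs.
rewrite add0n IHs //; have le_i k : (nth 0 (x :: s) k <= i)%N.
  apply: leq_trans xi; have [k_s | s_k] := ltnP k (size (x :: s)).
    by rewrite (head_max xs) ?mem_nth.
  by rewrite nth_default.
by rewrite (ltnNge _ (nth _ s j)) (le_i j.+1) ltnNge le_i.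
Qed.

Section Tableaux.
Variable n : nat.
Implicit Type mu : intpart n.

(* The boxes (row, column) of the Young diagram, counted from 0; both indices
   are always smaller than n. *)
Definition cell mu := {c : 'I_n * 'I_n | (c.2 < nth 0 mu c.1)%N}.

Definition row_of mu (c : cell mu) : 'I_n := (val c).1.
Definition col_of mu (c : cell mu) : 'I_n := (val c).2.

Lemma card_cell mu : #|{: cell mu}| = n.
Proof.
have /and3P[mu_sorted mu_pos /eqP sum_mu] := partsP mu.
have size_mu : (size mu <= n)%N.
  rewrite -{2}sum_mu sumnE -sum1_size big_seq [leqRHS]big_seq.
  by apply: leq_sum => -[|x] // x_mu; rewrite x_mu in mu_pos.
have nth_mu i : (nth 0 mu i <= n)%N.
  have [i_mu | mu_i] := ltnP i (size mu); last by rewrite nth_default.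
  by rewrite -{2}sum_mu sumnE (big_rem (nth 0 mu i)%N) ?mem_nth //= leq_addr.
rewrite card_sig -sum1_card -(pair_big_dep xpredT
  (fun i j : 'I_n => j < nth 0 mu i)%N (fun _ _ => 1%N)) /=.
under eq_bigr => i _.
  rewrite (big_ord_narrow (nth_mu i)) sum1_card card_ord; over.
apply: etrans sum_mu; rewrite sumnE (big_nth 0%N).
rewrite -(big_mkord xpredT (nth 0%N mu)).
rewrite (big_cat_nat (leq0n _) size_mu) /= [X in (_ + X)%N]big1_seq ?addn0 //.
by move=> i; rewrite mem_index_iota => /and3P[_ mu_i _]; rewrite nth_default.
Qed.

(* The entries 1, ..., n are represented by 'I_n; since the diagram has n
   boxes, an injective filling uses each of them exactly once. *)
Definition tableau mu := {T : {ffun cell mu -> 'I_n} | injectiveb T}.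

Definition standard mu (T : tableau mu) :=
  [forall c, forall d,
     ((row_of c == row_of d) && (col_of c < col_of d)%N ==>
        (val T c < val T d)%N)
  && ((col_of c == col_of d) && (row_of c < row_of d)%N ==>
        (val T c < val T d)%N)].

Definition num_standard mu : nat := #|[pred T : tableau mu | standard T]|.

Definition row_stab mu (T : tableau mu) : {set 'S_n} :=
  \bigcap_(i < n) 'N([set val T c | c : cell mu & row_of c == i] | 'P)%g.

Definition col_stab mu (T : tableau mu) : {set 'S_n} :=
  \bigcap_(j < n) 'N([set val T c | c : cell mu & col_of c == j] | 'P)%g.

End Tableaux.

Section SymAlt.
Variables (F : fieldType) (n : nat).

Definition sym_alg : {vspace galg F 'S_n} := fullv.

Definition alt_alg : {vspace galg F 'S_n} := gspan F ('Alt_('I_n))%g.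

(* In 'S_n the product q * p applies q first.  With the opposite composition
   order one gets the image of this element under the group isomorphism
   g |-> g^-1 between the two conventions. *)
Definition young_idem mu (T : tableau mu) : galg F 'S_n :=
  ((num_standard mu)%:R / n`!%:R) *:
    \sum_(p in row_stab T) \sum_(q in col_stab T)
       (-1) ^+ odd_perm q *: gelt F (q * p)%g.

(* Objects described by a property that determines them are selected with xget,
   whose first argument is the value taken when nothing has the property. *)

Definition sym_component (mu : intpart n) : {vspace galg F 'S_n} :=
  classical_sets.xget 0%VS (fun J => minimal_ideal sym_alg J
    /\ forall T : tableau mu, young_idem T \in J).

Definition sym_idem (mu : intpart n) : galg F 'S_n :=
  classical_sets.xget 0 (fun e => is_algid e (sym_component mu)).

Definition alt_component (gamma : {pred intpart n}) :
    {vspace galg F 'S_n} :=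
  classical_sets.xget 0%VS (fun I =>
    forall mu, mu \in gamma -> forall T : tableau mu,
      component_of alt_alg (sym_alg * <[young_idem T]>)%VS I).

End SymAlt.

(* Main.v *)
Require Import Defs.
From HB Require Import structures.
From mathcomp Require Import all_boot all_order all_algebra all_fingroup.
From mathcomp Require Import all_solvable all_field.
From mathcomp Require Import zify.
From mathcomp Require classical_sets.

(* Let c_T be the Young symmetrizer of a tableau T of shape mu. The map
   a |-> c_T a c_T takes its values in the line of c_T, the trace form of the
   group algebra is nondegenerate because n! is nonzero, and d_mu is nonzero in
   the field by Frobenius' determinantal formula; hence J_mu is the two-sided
   ideal generated by c_T, and its identity is a multiple of
   sum_g g c_T g^-1. The sign twist tau : g |-> sgn(g) g is an involutive
   automorphism of F S_n with fixed algebra F A_n, and it exchanges J_lambda and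
   J_lambda', which annihilate each other. Therefore x |-> x + tau x is an
   algebra isomorphism of J_lambda onto F A_n e_lambda which is F A_n-linear, so
   that all assertions about F A_n e_lambda follow from the simplicity of
   J_lambda. *)

Set Implicit Arguments.
Unset Strict Implicit.
Unset Printing Implicit Defensive.

Import GRing.Theory.
Local Open Scope ring_scope.

(** * Quasi-primitive elements of semiprime algebras *)

(** Here [num_standard] is only a count of tableaux, not tied to the dimension of a module, so its
    invertibility in F is a combinatorial question. Frobenius' identity answers it because the side
    without the count is, up to sign, a product of integers between 1 and n. Two asymmetries of c_T
    = C_T R_T have to be absorbed. For distinct shapes, dominance makes c_S A c_T vanish in one
    order only; centrality of the idempotents supplies the other. And tau turns C_T R_T into R_T'
    C_T' for the transposed tableau T', with the factors in the wrong order, so R C must be shown to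
    lie in the same ideal as C R. *)

Definition semiprime (F : fieldType) (aT : falgType F) :=
  forall x : aT, (forall a, x * a * x = 0) -> x = 0.

Section SemiprimeAlgebra.
Variables (F : fieldType) (aT : falgType F).
Hypothesis aT_semiprime : semiprime aT.
Implicit Types (a b c x y : aT) (B I K L M : {vspace aT}).

Lemma ideal_line c : ideal {:aT} ({:aT} * <[c]> * {:aT})%VS.
Proof.
rewrite /ideal subvf /= !prodvA prodv_id -!prodvA prodv_id.
by rewrite !subvv.
Qed.

(** An explicit witness is wanted: x a x is linear in a, so it suffices to test the finitely many
    vectors of a basis. *)
Lemma semiprime_neq0 x : x != 0 -> exists a, x * a * x != 0.
Proof.
move=> x0; have [i xi|x0'] := pickP (fun i : 'I_(\dim {:aT}) =>
  x * (vbasis {:aT})`_i * x != 0); first by exists (vbasis {:aT})`_i.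
case/eqP: x0; apply: aT_semiprime => a.
rewrite (coord_vbasis (memvf a)) mulr_sumr mulr_suml big1 // => i _.
by rewrite -scalerAr -scalerAl; have /negbFE/eqP-> := x0' i; rewrite scaler0.
Qed.

(** Scale-invariant form of a primitive idempotent whose corner is one-dimensional. *)
Definition quasi_primitive c := c != 0 /\ forall a, exists t, c * a * c = t *: c.

Section QuasiPrimitive.
Variable c : aT.
Hypothesis c_prim : quasi_primitive c.
Let J := ({:aT} * <[c]> * {:aT})%VS.

(** The left ideal of c is thus minimal. Semiprimeness gives a with (b c) a (b c) nonzero, so c (a
    b) c = t c with t nonzero, and dividing by t recovers c. *)
Lemma quasi_primitive_gen b : b * c != 0 -> exists a, a * (b * c) = c.
Proof.
move=> /semiprime_neq0[a abc]; have [t ct] := c_prim.2 (a * b).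
have t0 : t != 0.
  apply: contraNneq abc => t0.
  have -> : b * c * a * (b * c) = b * (c * (a * b) * c) by rewrite !mulrA.
  by rewrite ct t0 scale0r mulr0.
exists (t^-1 *: (c * a)).
by rewrite -scalerAl !mulrA -(mulrA c) ct scalerA mulVf ?scale1r.
Qed.

Lemma mem_line_l x : x \in ({:aT} * <[c]>)%VS -> exists b, x = b * c.
Proof. by case/memv_cosetP=> b _ ->; exists b. Qed.

Lemma mem_ideal_line a b : a * c * b \in J.
Proof. by rewrite !memv_mul ?memvf ?memv_line. Qed.

(** J is spanned by the products a c b. Phrasing the induction through a linear map turns linear
    identities on J into membership in the zero space. *)
Lemma ideal_line_ind K (f : 'End(aT)) :
  (forall a b, f (a * c * b) \in K) -> forall x, x \in J -> f x \in K.
Proof.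
move=> fK x xJ; rewrite memv_preim; apply: subvP x xJ.
apply/prodvP => _ b /memv_cosetP[a _ ->] _; rewrite -memv_preim; exact: fK.
Qed.

Lemma ideal_line_unit eps :
  (forall x, eps * x = x * eps) -> eps * c = c -> {in J, forall x, eps * x = x}.
Proof.
move=> epsC epsc x.
have fE y : (amull eps - \1)%VF y = eps * y - y.
  by rewrite add_lfunE opp_lfunE id_lfunE lfunE.
move=> xJ; apply/eqP; rewrite -subr_eq0 -fE -memv0.
apply: ideal_line_ind xJ => a b; rewrite fE memv0 subr_eq0.
by rewrite !mulrA epsC -(mulrA a) epsc.
Qed.

Lemma quasi_primitive_ideal x : x \in J -> x != 0 -> exists a b, a * x * b = c.
Proof.
move=> xJ x0; have [a xax] := semiprime_neq0 x0.
have [i xi|x0'] := pickP (fun i : 'I_(\dim {:aT}) =>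
  x * (vbasis {:aT})`_i * c != 0).
  have [b bxc] := quasi_primitive_gen xi.
  by exists b, ((vbasis {:aT})`_i * c); rewrite -[RHS]bxc !mulrA.
(* Otherwise x A c = 0, hence x A J = 0; as x is in J, this contradicts the choice of a with x a x
   nonzero. *)
have xac b : x * b * c = 0.
  rewrite (coord_vbasis (memvf b)) mulr_sumr mulr_suml big1 // => i _.
  by rewrite -scalerAr -scalerAl; have /negbFE/eqP-> := x0' i; rewrite scaler0.
case/negP: xax; rewrite -memv0.
rewrite (_ : x * a * x = amull (x * a) x); last by rewrite lfunE.
apply: ideal_line_ind xJ => b d; rewrite lfunE /= !mulrA -(mulrA x) xac mul0r.
exact: mem0v.
Qed.

Lemma minimal_ideal_line : minimal_ideal {:aT} J.
Proof.
have cJ : c \in J by have := mem_ideal_line 1 1; rewrite mul1r mulr1.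
split; first exact: ideal_line.
  by apply: contraTneq cJ => ->; rewrite memv0; case: c_prim.
move=> K /and3P[_ AK KA] KJ K0; apply/eqP; rewrite eqEsubv KJ /=.
have [a [b abc]] := quasi_primitive_ideal (subvP KJ _ (memv_pick K))
  (etrans (congr1 negb (vpick0 K)) K0).
have cK : c \in K.
  rewrite -abc; apply: (subvP KA); rewrite memv_mul ?memvf //.
  by apply: (subvP AK); rewrite memv_mul ?memvf ?memv_pick.
apply: (subv_trans _ KA); rewrite prodvSl //; apply: (subv_trans _ AK).
by rewrite prodvSr // -memvE.
Qed.

End QuasiPrimitive.

Lemma minimal_ideal_eq B I K x :
  minimal_ideal B I -> minimal_ideal B K -> x != 0 -> x \in I -> x \in K -> I = K.
Proof.
move=> [/and3P[IB BI IB'] _ Imin] [/and3P[_ BK KB] _ Kmin] x0 xI xK.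
have idIK : ideal B (I :&: K)%VS.
  apply/and3P; split; first by apply: subv_trans (capvSl _ _) IB.
    rewrite subv_cap (subv_trans _ BI) ?prodvSr ?capvSl //.
    by rewrite (subv_trans _ BK) ?prodvSr ?capvSr.
  rewrite subv_cap (subv_trans _ IB') ?prodvSl ?capvSl //.
  by rewrite (subv_trans _ KB) ?prodvSl ?capvSr.
have IK0 : (I :&: K)%VS != 0%VS.
  by apply: contraNneq x0 => IK0; rewrite -memv0 -IK0 memv_cap xI.
by rewrite -(Imin _ idIK (capvSl _ _) IK0) [RHS](esym (Kmin _ idIK (capvSr _ _) IK0)).
Qed.

End SemiprimeAlgebra.

(** * The fixed subalgebra of an involution swapping two blocks *)

Lemma module_iso_sym (F : fieldType) (aT : falgType F) (B L M : {vspace aT}) :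
  (B * L <= L)%VS -> module_iso B L M -> module_iso B M L.
Proof.
move=> BL [f [f_inj fL f_lin]].
(* f is controlled only on L, so it is inverted after projecting to L; the second projection brings
   the chosen preimage back into L. *)
pose g := (f \o projv L)%VF; pose h := (projv L \o g^-1)%VF.
have fh v : v \in M -> f (h v) = v.
  rewrite -fL => /memv_imgP[u uL ->].
  rewrite comp_lfunE -[f (projv L _)]comp_lfunE limg_lfunVK // limg_comp.
  by rewrite memv_img // -{1}(projv_id uL) memv_img ?memvf.
have hL v : h v \in L by rewrite comp_lfunE memv_proj.
exists h; split=> [u v uM vM huv||b x bB xM].
- by rewrite -(fh u) // -(fh v) // huv.
- apply/eqP; rewrite eqEsubv; apply/andP; split; apply/subvP=> u.
    by case/memv_imgP=> v _ ->.
  move=> uL; have fuM : f u \in M by rewrite -fL memv_img.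
  by rewrite -(f_inj _ _ (hL _) uL (fh _ fuM)) memv_img.
have bhL : b * h x \in L by rewrite (subvP BL) ?memv_mul.
apply: f_inj => //; rewrite f_lin // !fh // -fL -(fh x xM) -f_lin //.
by rewrite memv_img.
Qed.

Section FixedSubalgebra.
Variables (F : fieldType) (aT : falgType F).
Hypothesis aT_semiprime : semiprime aT.
Variables (B : {vspace aT}) (tau : 'End(aT)).
Hypotheses (tauM : {morph tau : x y / x * y}) (tauK : involutive tau).
Hypothesis BP : forall x, reflect (tau x = x) (x \in B).
Implicit Types (a b c x y eps : aT) (I K L M : {vspace aT}).

Let phi : 'End(aT) := (\1 + tau)%VF.

Let phiE x : phi x = x + tau x. Proof. by rewrite add_lfunE id_lfunE. Qed.

Let phi_in x : phi x \in B.
Proof. by apply/BP; rewrite phiE linearD /= tauK addrC. Qed.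

Let phiBl b x : b \in B -> phi (b * x) = b * phi x :> aT.
Proof. by move=> /BP bB; rewrite !phiE tauM bB mulrDr. Qed.

Let BM : {in B &, forall x y, x * y \in B}.
Proof. by move=> x y /BP Bx /BP By; apply/BP; rewrite tauM Bx By. Qed.

Section Swapped.
Variables (c eps : aT).
Let J := ({:aT} * <[c]> * {:aT})%VS.
Let M := ({:aT} * <[c]>)%VS.
Hypotheses (c_prim : quasi_primitive c) (epsJ : eps \in J).
Hypotheses (epsC : forall x, eps * x = x * eps) (epsc : eps * c = c).
Hypothesis eps_tau : eps * tau eps = 0.
Let e := eps + tau eps.

Let ephi : e = phi eps. Proof. by rewrite phiE. Qed.

Let eB : e \in B. Proof. by rewrite ephi phi_in. Qed.

Let epsl x : x \in J -> eps * x = x.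
Proof. exact: ideal_line_unit. Qed.

Let epsr x : x \in J -> x * eps = x.
Proof. by rewrite -epsC; apply: epsl. Qed.

Let eps_id : eps * eps = eps. Proof. exact: epsl. Qed.

Let cJ : c \in J. Proof. by have := mem_ideal_line c 1 1; rewrite mul1r mulr1. Qed.

Let JM a b x : x \in J -> a * x * b \in J.
Proof.
have /and3P[_ AJ JA] := ideal_line c.
move=> xJ; apply: (subvP JA); apply: memv_mul; last exact: memvf.
by apply: (subvP AJ); apply: memv_mul; first exact: memvf.
Qed.

Let JMl a x : x \in J -> a * x \in J.
Proof. by move=> xJ; rewrite -[_ * _]mulr1 JM. Qed.

Let JMr x b : x \in J -> x * b \in J.
Proof. by move=> xJ; rewrite -[x]mul1r JM. Qed.

Let MJ x : x \in M -> x \in J.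
Proof. by case/mem_line_l=> b ->; apply: JMl. Qed.

Let tau_eps x : tau eps * x = x * tau eps.
Proof. by rewrite -[x]tauK -!tauM epsC. Qed.

Let eC x : e * x = x * e.
Proof. by rewrite mulrDl mulrDr epsC tau_eps. Qed.

(** The cross terms x tau(y) and tau(x) y vanish, since x = x eps, y = eps y and eps tau(eps) =
    0. *)
Let phiM x y : x \in J -> y \in J -> phi x * phi y = phi (x * y).
Proof.
move=> xJ yJ; rewrite !phiE tauM mulrDl !mulrDr.
have -> : x * tau y = 0.
  by rewrite -(epsr xJ) -(epsl yJ) tauM -!mulrA (mulrA eps) eps_tau mul0r mulr0.
have -> : tau x * y = 0.
  rewrite -(epsr xJ) -(epsl yJ) tauM -!mulrA (mulrA _ eps) tau_eps eps_tau.
  by rewrite mul0r mulr0.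
by rewrite addr0 add0r.
Qed.

Let eps_phi x : x \in J -> eps * phi x = x.
Proof.
move=> xJ; have tx0 : eps * tau x = 0.
  by rewrite -(epsl xJ) tauM mulrA eps_tau mul0r.
by rewrite phiE mulrDr tx0 addr0 epsl.
Qed.

Let phi_eps x : x \in B -> phi (eps * x) = e * x.
Proof. by move=> /BP xB; rewrite phiE tauM xB mulrDl. Qed.

(** On J every element of the whole algebra acts like an element of B. This is why [M] stays
    irreducible over B. *)
Let phi_act x y : y \in J -> phi (x * eps) * y = x * y.
Proof.
move=> yJ; have ty0 : tau (x * eps) * y = 0.
  by rewrite tauM -(epsl yJ) -mulrA (mulrA _ eps) tau_eps eps_tau mul0r mulr0.
by rewrite phiE mulrDl ty0 addr0 -mulrA epsl.
Qed.

Let e_id : e * e = e.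
Proof. by rewrite ephi phiM // eps_id. Qed.

Let e_neq0 : e != 0.
Proof.
apply: contraNneq c_prim.1 => e0.
by rewrite -epsc -(eps_phi epsJ) -ephi e0 mulr0 mul0r.
Qed.

Let I := (B * <[e]>)%VS.

Let mem_Be x : (x \in I) = (x \in B) && (e * x == x).
Proof.
apply/memv_cosetP/andP=> [[b bB ->]|[xB /eqP ex]].
  by split; [apply: BM | rewrite eC -mulrA e_id].
by exists x; rewrite // -eC.
Qed.

Let minimal_Be : minimal_ideal B I.
Proof.
split.
- apply/and3P; split; first by apply/prodvP=> x y xB /vlineP[k ->];
    rewrite BM ?memvZ.
    rewrite prodvA prodvSl //; apply/prodvP; exact: BM.
  apply/prodvP=> x y; rewrite !mem_Be => /andP[xB /eqP ex] yB.
  by rewrite BM // mulrA ex eqxx.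
- by apply: contraNneq e_neq0 => I0; rewrite -memv0 -I0 mem_Be eB e_id eqxx.
move=> K /and3P[_ BK KB] KI K0; apply/eqP; rewrite eqEsubv KI /=.
have BKB a x b : a \in B -> x \in K -> b \in B -> a * x * b \in K.
  move=> aB xK bB; rewrite (subvP KB) // memv_mul //.
  by rewrite (subvP BK) // memv_mul.
pose x := vpick K; have xK : x \in K := memv_pick K.
have := subvP KI x xK; rewrite mem_Be => /andP[xB /eqP ex].
(* eps x is the component of x in J, and x = phi (eps x). Simplicity of J turns eps x into c, and
   [phiM] carries this relation back to B. *)
have yJ : eps * x \in J by apply: JMr.
have xy : x = phi (eps * x) by rewrite phi_eps.
have y0 : eps * x != 0.
  apply: contraNneq K0 => y0; rewrite -vpick0 -/x xy y0.
  by rewrite linear0.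
have [a [b abc]] := quasi_primitive_ideal aT_semiprime c_prim yJ y0.
have cK : phi c \in K.
  have -> : c = (a * eps) * (eps * x) * (eps * b).
    by rewrite mulrA -(mulrA a) epsl // -(mulrA a) epsr.
  have aJ : a * eps \in J by apply: JMl.
  have bJ : eps * b \in J by apply: JMr.
  by rewrite -(phiM (JMl _ yJ) bJ) -(phiM aJ yJ) -xy BKB.
have eK : e \in K.
  rewrite ephi; apply: ideal_line_ind epsJ => a1 b1.
  have -> : a1 * c * b1 = (a1 * eps) * c * (eps * b1).
    by rewrite mulrA -(mulrA a1 eps) epsc -(mulrA a1 c eps) -epsC epsc.
  have {}aJ : a1 * eps \in J by apply: JMl.
  have {}bJ : eps * b1 \in J by apply: JMr.
  by rewrite -(phiM (JMl _ cJ) bJ) -(phiM aJ cJ) BKB.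
apply/prodvP=> b' _ b'B /vlineP[k ->].
by rewrite -scalerAr memvZ // (subvP BK) // memv_mul.
Qed.

(** For e = f + g the ideal B f is nonzero and lies in B e, so it equals B e by minimality. Then e f
    = e, while orthogonality gives e f = f; hence g = 0. *)
Lemma centrally_primitive_trace : centrally_primitive B e.
Proof.
have BZ f : f \in 'Z(B)%VS -> f \in B /\ {in B, forall x, f * x = x * f}.
  by rewrite memv_cap => /andP[-> /centvP].
split=> //; first split=> //.
  by rewrite memv_cap eB; apply/centvP=> x _; apply: eC.
case=> f [g [[[fZ ff] [gZ gg] f0 g0] [fg gf efg]]].
have [fB fC] := BZ f fZ.
have Bf : ideal B (B * <[f]>)%VS.
  apply/and3P; split; first by apply/prodvP=> x y xB /vlineP[k ->];
    rewrite BM ?memvZ.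
    rewrite prodvA prodvSl //; apply/prodvP; exact: BM.
  apply/prodvP=> x y /memv_cosetP[a aB ->] yB.
  by rewrite -mulrA fC // mulrA memv_mul ?memv_line ?BM.
have ef : e * f = f by rewrite efg mulrDl ff gf addr0.
have BfI : (B * <[f]> <= I)%VS.
  apply/subvP=> x /memv_cosetP[a aB ->].
  by rewrite mem_Be BM //= mulrA eC -mulrA ef.
have f_in : f \in (B * <[f]>)%VS by apply/memv_cosetP; exists f.
have Bf0 : (B * <[f]>)%VS != 0%VS.
  by apply: contraNneq f0 => Bf0; rewrite -memv0 -Bf0.
have [_ _ /(_ _ Bf BfI Bf0) BfE] := minimal_Be.
have : e \in (B * <[f]>)%VS by rewrite BfE mem_Be eB e_id eqxx.
case/memv_cosetP=> a _ ea; have : e * f = e by rewrite ea -mulrA ff.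
by rewrite ef => fe; case/eqP: g0; apply: (addrI f); rewrite -efg addr0.
Qed.

Let M_stable : (B * M <= M)%VS.
Proof. by rewrite prodvA prodvSl ?subvf. Qed.

Lemma component_of_trace : component_of B M (B * <[e]>)%VS.
Proof.
split=> [//|L [/andP[LB BL] L0 Lmin]]; split=> [LI|[f [f_inj fL f_lin]]].
- apply: module_iso_sym => //.
  pose x := vpick L; have xL : x \in L := memv_pick L.
  have := subvP LI x xL; rewrite mem_Be => /andP[xB /eqP ex].
  have xy : x = phi (eps * x) by rewrite phi_eps.
  have y0 : eps * x != 0.
    apply: contraNneq L0 => y0; rewrite -vpick0 -/x xy y0.
    by rewrite linear0.
  have yJ : eps * x \in J by apply: JMr.
  have [a [b abc]] := quasi_primitive_ideal aT_semiprime c_prim yJ y0.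
  (* The map psi below sends z to phi (z d a) x, from [M] to L. The choice of d makes it nonzero at
     c: eps psi(c) = c d a x, and multiplying this by eps b on the right gives c d c. *)
  have [d cdc] := semiprime_neq0 aT_semiprime c_prim.1.
  have cy : c * (d * a) * x != 0.
    apply: contraNneq cdc => cx.
    have -> : c * d * c = c * (d * a) * x * (eps * b).
      by rewrite -{2}abc epsC !mulrA.
    by rewrite cx mul0r.
  have amulrE u y : amulr u y = y * u by rewrite lfunE.
  pose psi : 'End(aT) := (amulr x \o phi \o amulr (d * a))%VF.
  have psiE z : psi z = phi (z * (d * a)) * x :> aT.
    by rewrite comp_lfunE comp_lfunE !amulrE.
  have psi_lin b' y : b' \in B -> psi (b' * y) = b' * psi y :> aT.
    by move=> b'B; rewrite !psiE -mulrA phiBl //; apply/esym/mulrA.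
  have psic : psi c != 0.
    apply: contraNneq cy => psic; have := psiE c.
    move/(congr1 (fun z : aT => eps * z)); rewrite psic mulr0 => /esym.
    by rewrite (mulrA eps) eps_phi ?JMr // => ->.
  (* A nonzero y in [M] yields c already under multiplication by B, thanks to [phi_act], so psi y =
     0 would force psi c = 0. *)
  have psi_inj0 y : y \in M -> psi y = 0 -> y = 0.
    move=> yM psiy; apply/eqP; apply: contraNT psic => y0'.
    have [u yu] := mem_line_l yM; move: y0'; rewrite yu => y0'.
    have [v vc] := quasi_primitive_gen aT_semiprime c_prim y0'.
    have -> : c = phi (v * eps) * y by rewrite phi_act ?MJ // yu vc.
    by rewrite psi_lin ?phi_in // psiy mulr0.
  have psiL : (psi @: M <= L)%VS.
    apply/subvP=> _ /memv_imgP[y _ ->]; rewrite psiE (subvP BL) //.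
    by rewrite memv_mul ?phi_in.
  have cM : c \in M by rewrite -[c]mul1r memv_mul ?memvf ?memv_line.
  exists psi; split=> [y z yM zM yz||b' y b'B _]; last exact: psi_lin.
    apply/eqP; rewrite -subr_eq0; apply/eqP/psi_inj0; first by rewrite rpredB.
    by rewrite linearB /= yz subrr.
  apply: Lmin => //; last first.
    by apply: contraNneq psic => psiM0; rewrite -memv0 -psiM0 memv_img.
  apply/andP; split; first exact: subv_trans LB.
  apply/prodvP=> b' _ b'B /memv_imgP[y yM ->]; rewrite -psi_lin // memv_img //.
  by rewrite (subvP M_stable) // memv_mul.
(* Conversely, e acts as the identity on [M], hence on any L isomorphic to it, and e x = x puts x in
   B e. *)
apply/subvP=> x xL; rewrite mem_Be (subvP LB) //=; apply/eqP; apply: f_inj => //.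
  by rewrite (subvP BL) // memv_mul.
have fxM : f x \in M by rewrite -fL memv_img.
by rewrite f_lin // ephi -[eps]mul1r phi_act ?mul1r // MJ.
Qed.

(** [component_of] pins down its ideal once some minimal left ideal isomorphic to [M] exists. The
    image of [M] under phi is one; it lies in both K and B e, so these two minimal ideals meet and
    coincide. *)
Lemma component_of_trace_unique K : component_of B M K -> K = (B * <[e]>)%VS.
Proof.
have cM : c \in M by rewrite -[c]mul1r memv_mul ?memvf ?memv_line.
have phic : phi c != 0.
  by apply: contraNneq c_prim.1 => phic; rewrite -(eps_phi cJ) phic mulr0.
pose L := (phi @: M)%VS; have phicL : phi c \in L by rewrite memv_img.
have Lmin : minimal_left_ideal B L.
  split.
  - apply/andP; split; first by apply/subvP=> _ /memv_imgP[y _ ->].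
    apply/prodvP=> b _ bB /memv_imgP[y yM ->]; rewrite -phiBl // memv_img //.
    by rewrite (subvP M_stable) // memv_mul.
  - by apply: contraNneq phic => L0; rewrite -memv0 -L0.
  move=> N /andP[_ BN] NL N0; apply/eqP; rewrite eqEsubv NL /=.
  have /memv_imgP[y yM xy] := subvP NL _ (memv_pick N).
  have y0 : y != 0 by apply: contraNneq N0 => y0; rewrite -vpick0 xy y0 linear0.
  have [u yu] := mem_line_l yM; move: y0; rewrite yu => y0.
  have [v vc] := quasi_primitive_gen aT_semiprime c_prim y0.
  apply/subvP=> _ /memv_imgP[_ /mem_line_l[b ->] ->].
  have -> : b * c = (b * v * eps) * y.
    by rewrite -!mulrA (epsl (MJ yM)) yu vc.
  by rewrite -(phiM (JMl _ epsJ) (MJ yM)) -xy (subvP BN) // memv_mul ?memv_pick.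
have Liso : module_iso B L M.
  apply: module_iso_sym => //; exists phi; split=> // [y z yM zM yz|b y bB _].
    by rewrite -(eps_phi (MJ yM)) yz eps_phi ?MJ.
  exact: phiBl.
case=> Kmin KP; have [Imin IP] := component_of_trace.
apply: (minimal_ideal_eq Kmin Imin phic).
  by apply: subvP phicL; apply/KP.
by apply: subvP phicL; apply/IP.
Qed.

End Swapped.
End FixedSubalgebra.

(** * Group algebras *)

(** For a rank factorization A = C R, full rank lets the outer factors be cancelled from C R C R =
    0, so R C = 0, and C R has the same trace as R C. *)
Lemma mxtrace_sqr0 (F : fieldType) n (A : 'M[F]_n) : A *m A = 0 -> \tr A = 0.
Proof.
suff swap0 r (C : 'M[F]_(n, r)) (R : 'M[F]_(r, n)) :
    row_full C -> row_free R -> C *m R *m (C *m R) = 0 -> R *m C = 0.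
  move=> AA; rewrite -(mulmx_base A) mxtrace_mulC swap0 ?mxtrace0 ?mulmx_base //.
    exact: col_base_full.
  exact: row_base_free.
move=> fullC freeR CR0; apply: (row_full_inj fullC); apply: (row_free_inj freeR).
by rewrite /= mulmx0 mul0mx -CR0 !mulmxA.
Qed.

Section GroupAlgebra.
Variables (F : fieldType) (gT : finGroupType).
Hypothesis card_neq0 : #|gT|%:R != 0 :> F.
Local Notation A := (galg F gT).
Implicit Types (a b c x : A) (g h : gT).

Lemma gelt_mull g a h : (gelt F g * a) h = a (g^-1 * h)%g.
Proof.
rewrite galgME (bigD1 g) //= ffunE eqxx mul1r big1 ?addr0 // => k /negPf kg.
by rewrite ffunE kg mul0r.
Qed.

Lemma gelt_mulr g a h : (a * gelt F g) h = a (h * g^-1)%g.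
Proof.
rewrite galgME (bigD1 (h * g^-1)%g) //= ffunE invMg invgK mulgKV eqxx mulr1.
rewrite big1 ?addr0 // => k /negPf kg; rewrite ffunE.
by rewrite -(inj_eq (mulgI k)) mulKVg -(inj_eq (mulIg g^-1%g)) mulgK eq_sym kg mulr0.
Qed.

Lemma galg_sum a : a = \sum_g a g *: gelt F g.
Proof.
apply/ffunP=> h; rewrite sum_ffunE (bigD1 h) //= galgZE ffunE eqxx mulr1.
rewrite big1 ?addr0 // => g /negPf gh.
by rewrite galgZE ffunE eq_sym gh mulr0.
Qed.

(** Regular representation on row vectors: row i holds the coordinates of the i-th group element
    times a, so products keep their order. *)
Definition left_mul_mx a : 'M[F]_#|gT| :=
  \matrix_(i, j) a ((enum_val i)^-1 * enum_val j)%g.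

Lemma left_mul_mxM a b : left_mul_mx a *m left_mul_mx b = left_mul_mx (a * b).
Proof.
apply/matrixP=> i j; rewrite !mxE galgME.
rewrite (reindex_inj (mulgI (enum_val i)^-1)%g) /=.
rewrite (reindex (fun k : 'I_#|gT| => enum_val k)) /=; last first.
  by exists enum_rank => k _; rewrite (enum_rankK, enum_valK).
by apply: eq_bigr => k _; rewrite !mxE invMg invgK -mulgA mulKVg.
Qed.

Lemma mxtrace_left_mul a : \tr (left_mul_mx a) = #|gT|%:R * a 1%g.
Proof.
rewrite /mxtrace (eq_bigr (fun=> a 1%g)) => [|i _].
  by rewrite sumr_const card_ord mulr_natl.
by rewrite mxE mulVg.
Qed.

Lemma sqr0_coef1 a : a * a = 0 -> a 1%g = 0.
Proof.
move=> aa; have /eqP := mxtrace_left_mul a.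
rewrite mxtrace_sqr0 ?left_mul_mxM ?aa.
  by rewrite eq_sym mulf_eq0 (negPf card_neq0) => /eqP.
by apply/matrixP=> i j; rewrite !mxE ffunE.
Qed.

(** If x A x = 0, then each [gelt F g^-1 * x] has square zero, and its coefficient at 1 is [x g]. *)
Lemma galg_semiprime : semiprime A.
Proof.
move=> x xAx; apply/ffunP=> g; rewrite ffunE.
have := @sqr0_coef1 (gelt F g^-1%g * x).
rewrite gelt_mull invgK mulg1; apply.
by rewrite -mulrA (mulrA x) xAx mulr0.
Qed.

(** Since z is central, k z c = c z c = u c, whence the scalar u / k in z c and in z z. Both k and u
    / k are nonzero because c and z have a nonzero coefficient at 1 and so cannot square to zero. *)
Lemma quasi_primitive_idem c : quasi_primitive c -> c 1%g != 0 ->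
  exists eps, [/\ eps \in ({:A} * <[c]> * {:A})%VS,
    forall x, eps * x = x * eps & eps * c = c].
Proof.
move=> [c0 cP] c1.
pose z : A := \sum_g gelt F g * c * gelt F g^-1%g.
have zC x : z * x = x * z.
  rewrite (galg_sum x) mulr_sumr mulr_suml; apply: eq_bigr => h _.
  rewrite -scalerAr -scalerAl; congr (_ *: _); rewrite /z mulr_sumr mulr_suml.
  rewrite [LHS](reindex_inj (mulgI h)) /=; apply: eq_bigr => g _.
  by rewrite -!mulrA -geltM invMg mulgKV geltM -!mulrA.
have z1 : z 1%g != 0.
  rewrite sum_ffunE (eq_bigr (fun=> c 1%g)) => [|g _].
    by rewrite sumr_const -mulr_natl mulf_neq0.
  by rewrite gelt_mulr gelt_mull invgK mul1g mulVg.
have [k ck] := cP 1; rewrite mulr1 in ck.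
have k0 : k != 0 by apply: contraNneq c1 => k0; rewrite sqr0_coef1 ?ck ?k0 ?scale0r.
have [u cu] := cP z.
have zc : z * c = (u / k) *: c.
  apply: (scalerI k0); rewrite scalerA mulrC divfK // -cu -zC -mulrA ck.
  by rewrite scalerAr.
have zz : z * z = (u / k) *: z.
  rewrite {2}/z mulr_sumr /z scaler_sumr -/z; apply: eq_bigr => g _.
  by rewrite !mulrA zC -(mulrA _ z) zc -scalerAr -scalerAl.
have uk0 : u / k != 0.
  by apply: contraNneq z1 => uk0; rewrite sqr0_coef1 // zz uk0 scale0r.
exists ((u / k)^-1 *: z); split.
- rewrite memvZ // memv_suml // => g _.
  by rewrite !memv_mul ?memvf ?memv_line.
- by move=> x; rewrite -scalerAl -scalerAr zC.
by rewrite -scalerAl zc scalerA mulVf ?scale1r.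
Qed.

End GroupAlgebra.

(** * Coordinates in a tableau *)

Lemma widen_ord_inj m n (le_mn : (m <= n)%N) : injective (widen_ord le_mn).
Proof. by move=> i j /(congr1 val) /= /val_inj. Qed.

Section Coordinates.
Variable n : nat.
Implicit Types mu nu : intpart n.

Lemma nth_intpart_size mu i : (0 < nth 0%N mu i)%N = (i < size mu)%N.
Proof.
have /and3P[_ mu_pos _] := partsP mu.
have [i_mu|mu_i] := ltnP i (size mu); last by rewrite nth_default.
by rewrite lt0n; apply: contraNneq mu_pos => <-; apply: mem_nth.
Qed.

Lemma size_intpart mu : (size mu <= n)%N.
Proof.
have /and3P[_ mu_pos /eqP sum_mu] := partsP mu.
rewrite -{2}sum_mu sumnE -sum1_size big_seq [leqRHS]big_seq.
by apply: leq_sum => -[|x] // x_mu; rewrite x_mu in mu_pos.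
Qed.

Lemma nth_intpart_le mu i : (nth 0 mu i <= n)%N.
Proof.
have /and3P[_ _ /eqP sum_mu] := partsP mu.
have [i_mu|mu_i] := ltnP i (size mu); last by rewrite nth_default.
by rewrite -{2}sum_mu sumnE (big_rem (nth 0%N mu i)) ?mem_nth //= leq_addr.
Qed.

Lemma intpart_eq mu nu : (forall i : 'I_n, nth 0%N mu i = nth 0%N nu i) -> mu = nu.
Proof.
move=> eq_nth.
have {}eq_nth i : nth 0%N mu i = nth 0%N nu i.
  have [i_n|n_i] := ltnP i n; first exact: (eq_nth (Ordinal i_n)).
  by rewrite !nth_default // (leq_trans (size_intpart _)).
apply/val_inj; apply: (@eq_from_nth _ 0%N) => //.
have lt_size i : (i < size mu)%N = (i < size nu)%N.
  by rewrite -!nth_intpart_size eq_nth.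
by apply/eqP; rewrite eqn_leq leqNgt lt_size ltnn leqNgt -lt_size ltnn.
Qed.

Section Tableau.
Variables (mu : intpart n) (T : tableau mu).

Lemma tableau_inj : injective (val T).
Proof. exact/injectiveP/(valP T). Qed.

Lemma tableau_onto x : x \in codom (val T).
Proof. by apply: inj_card_onto tableau_inj _ _; rewrite card_cell card_ord. Qed.

Definition box_of x : cell mu := iinv (tableau_onto x).

Definition tab_row x := row_of (box_of x).
Definition tab_col x := col_of (box_of x).

Lemma tableauK : cancel (val T) box_of.
Proof. by move=> c; apply: tableau_inj; rewrite f_iinv. Qed.

Lemma box_ofK : cancel box_of (val T).
Proof. by move=> x; rewrite f_iinv. Qed.

Lemma tab_col_lt x : (tab_col x < nth 0 mu (tab_row x))%N.
Proof. exact: (valP (box_of x)). Qed.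

Lemma tab_coord_inj x y : tab_row x = tab_row y -> tab_col x = tab_col y -> x = y.
Proof.
move=> rxy cxy; apply: (can_inj box_ofK); apply: val_inj.
by move: rxy cxy; rewrite /tab_row /tab_col /row_of /col_of;
  case: (val (box_of x)) (val (box_of y)) => [i j] [i' j'] /= -> ->.
Qed.

Lemma tab_coord_onto (i j : 'I_n) : (j < nth 0 mu i)%N ->
  exists x, tab_row x = i /\ tab_col x = j.
Proof.
move=> ij; pose c : cell mu := Sub (i, j) ij.
by exists (val T c); rewrite /tab_row /tab_col tableauK.
Qed.

Lemma row_stabP (p : 'S_n) :
  reflect (forall x, tab_row (p x) = tab_row x) (p \in row_stab T).
Proof.
have in_row x i : (x \in [set val T c | c : cell mu & row_of c == i])
    = (tab_row x == i).
  rewrite /tab_row -{1}[x]box_ofK mem_imset; last exact: tableau_inj.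
  by rewrite inE.
apply: (iffP bigcapP) => [pR x|pR i _].
  have /astabsP/(_ x) := pR (tab_row x) isT.
  by rewrite !in_row eqxx => /eqP.
by apply/astabsP=> x; rewrite !in_row /= apermE pR.
Qed.

Lemma col_stabP (p : 'S_n) :
  reflect (forall x, tab_col (p x) = tab_col x) (p \in col_stab T).
Proof.
have in_col x i : (x \in [set val T c | c : cell mu & col_of c == i])
    = (tab_col x == i).
  rewrite /tab_col -{1}[x]box_ofK mem_imset; last exact: tableau_inj.
  by rewrite inE.
apply: (iffP bigcapP) => [pR x|pR i _].
  have /astabsP/(_ x) := pR (tab_col x) isT.
  by rewrite !in_col eqxx => /eqP.
by apply/astabsP=> x; rewrite !in_col /= apermE pR.
Qed.

Lemma card_row_initial (i : 'I_n) j0 : (j0 <= n)%N ->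
  #|[set x | tab_row x == i & (tab_col x < j0)%N]| = minn (nth 0%N mu i) j0.
Proof.
move=> j0n; have mn : (minn (nth 0%N mu i) j0 <= n)%N by rewrite geq_min j0n orbT.
rewrite -[RHS]card_ord -(card_imset _ (@widen_ord_inj _ _ mn)).
rewrite -(card_in_imset (f := tab_col)) => [|x y]; last first.
  rewrite !inE => /andP[/eqP rx _] /andP[/eqP ry _]; apply: tab_coord_inj.
  by rewrite rx ry.
apply: eq_card => j; apply/imsetP/imsetP => [[x]|[k _ ->]].
  rewrite inE => /andP[/eqP rx xj0] ->.
  have lt : (tab_col x < minn (nth 0%N mu i) j0)%N.
    by rewrite leq_min xj0 -rx tab_col_lt.
  by exists (Ordinal lt) => //; apply: val_inj.
have := ltn_ord k; rewrite leq_min => /andP[k_mu k_j0].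
have [x [rx cx]] := @tab_coord_onto i (widen_ord mn k) k_mu.
by exists x => //; rewrite inE rx eqxx cx.
Qed.

End Tableau.

Lemma exists_tableau mu : exists T : tableau mu, True.
Proof.
pose f := [ffun c : cell mu => cast_ord (card_cell mu) (enum_rank c)].
have f_inj : injectiveb f.
  by apply/injectiveP=> c d; rewrite !ffunE => /cast_ord_inj/enum_rank_inj.
by exists (Sub f f_inj).
Qed.

(* Put x in the box (row of g x in T, column of x in S): when this is injective,
   row i receives at most as many entries as it has in T, and column j exactly as
   many as in S. *)
Section Packing.
Variables (mu nu : intpart n) (T : tableau mu) (S : tableau nu) (g : 'S_n).
Hypothesis packing : forall x y, tab_col S x = tab_col S y ->
  tab_row T (g x) = tab_row T (g y) -> x = y.

Let packed i j0 := #|[set x | tab_row T (g x) == i & (tab_col S x < j0)%N]|.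

Lemma packed_le (i : 'I_n) j0 : (j0 <= n)%N ->
  (packed i j0 <= minn (nth 0 mu i) j0)%N.
Proof.
move=> j0n; rewrite leq_min; apply/andP; split.
  apply: (@leq_trans #|[set x | tab_row T x == i & (tab_col T x < n)%N]|).
    rewrite /packed -(card_imset _ (@perm_inj _ g)); apply: subset_leq_card.
    apply/subsetP=> _ /imsetP[x + ->]; rewrite !inE => /andP[-> _].
    by rewrite ltn_ord.
  by rewrite card_row_initial // geq_minl.
rewrite /packed -(card_in_imset (f := tab_col S)) => [|x y]; last first.
  rewrite !inE => /andP[/eqP rx _] /andP[/eqP ry _] cxy.
  by apply: packing; rewrite // rx ry.
rewrite -[leqRHS]card_ord -(card_imset _ (@widen_ord_inj _ _ j0n)).
apply: subset_leq_card; apply/subsetP=> _ /imsetP[x + ->].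
rewrite inE => /andP[_ xj0]; apply/imsetP; exists (Ordinal xj0) => //.
exact: val_inj.
Qed.

Lemma sum_packed j0 : (j0 <= n)%N ->
  \sum_(i < n) packed i j0 = \sum_(i < n) minn (nth 0 nu i) j0.
Proof.
move=> j0n; transitivity #|[set x | (tab_col S x < j0)%N]|.
  rewrite -sum1_card [RHS](partition_big (fun x => tab_row T (g x)) xpredT) //=.
  apply: eq_bigr => i _; rewrite /packed -sum1_card; apply: eq_bigl => x.
  by rewrite !inE andbC.
rewrite -sum1_card [LHS](partition_big (tab_row S) xpredT) //=.
apply: eq_bigr => i _; rewrite -(card_row_initial S) // -sum1_card.
by apply: eq_bigl => x; rewrite !inE andbC.
Qed.

(** The truncated sum counts the boxes in the first [j0] columns, so over all [j0] this is dominance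
    between the conjugate partitions. *)
Lemma packing_dominance j0 : (j0 <= n)%N ->
  (\sum_(i < n) minn (nth 0 nu i) j0 <= \sum_(i < n) minn (nth 0 mu i) j0)%N.
Proof. by move=> j0n; rewrite -sum_packed // leq_sum // => i _; apply: packed_le. Qed.

End Packing.

(** Consecutive differences in [j0] are the column lengths, which determine the diagram by
    [conj_intpartP]. *)
Lemma sum_minn_inj mu nu :
  (forall j0, (j0 <= n)%N ->
    (\sum_(i < n) minn (nth 0 mu i) j0 = \sum_(i < n) minn (nth 0 nu i) j0)%N) ->
  mu = nu.
Proof.
move=> eq_sum.
have minnS m j : minn m j.+1 = (minn m j + (j < m))%N.
  by case: ltnP => [jm|mj]; rewrite ?addn1 ?addn0;
    [rewrite !(minn_idPr _) // ltnW | rewrite !(minn_idPl _) // leqW].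
have count_lt (m : intpart n) (j : 'I_n) :
    (\sum_(i < n) minn (nth 0 m i) j.+1 =
     \sum_(i < n) minn (nth 0 m i) j + minn (nth 0 (conj_intpart m) j) n)%N.
  under eq_bigr => i _ do rewrite minnS.
  rewrite big_split /=; congr addn; set k := nth _ _ j.
  rewrite (eq_bigr (fun i : 'I_n => if (i < k)%N then 1 else 0)%N); last first.
    by move=> i _; rewrite /k conj_intpartP; case: ltnP.
  rewrite -big_mkcond /=; set m' := minn _ _.
  rewrite (eq_bigl (fun i : 'I_n => (i < m')%N)); last first.
    by move=> i; rewrite leq_min ltn_ord andbT.
  by rewrite (big_ord_narrow (geq_minr k n)) sum1_card card_ord.
have eq_conj (j : 'I_n) : minn (nth 0%N (conj_intpart mu) j) n
    = minn (nth 0%N (conj_intpart nu) j) n.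
  apply: (@addnI (\sum_(i < n) minn (nth 0%N mu i) j)).
  by rewrite -count_lt eq_sum // count_lt eq_sum // ltnW.
have lt_nth (i j : 'I_n) : (j < nth 0 mu i)%N = (j < nth 0 nu i)%N.
  have conj_minn (m : intpart n) : (i < nth 0 (conj_intpart m) j)%N
      = (i < minn (nth 0 (conj_intpart m) j) n)%N.
    by rewrite leq_min ltn_ord andbT.
  by rewrite -[LHS]conj_intpartP conj_minn eq_conj -conj_minn conj_intpartP.
have le_nth (m1 m2 : intpart n) (i : 'I_n) :
    (forall j : 'I_n, (j < nth 0 m1 i)%N = (j < nth 0 m2 i)%N) ->
    (nth 0 m1 i <= nth 0 m2 i)%N.
  move=> lt_m; rewrite leqNgt; apply/negP => lt12.
  have := lt_m (Ordinal (leq_trans lt12 (nth_intpart_le _ _))).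
  by rewrite /= lt12 ltnn.
by apply: intpart_eq => i; apply/eqP; rewrite eqn_leq !le_nth.
Qed.

(** For equal shapes the summed bounds agree, so each bound of [packed_le] is an equality. If row i
    had no box in column j, the counts for j and j + 1 would both be the row length, although x is
    counted only in the second. *)
Lemma packing_self mu (T : tableau mu) (g : 'S_n) :
  (forall x y, tab_col T x = tab_col T y ->
     tab_row T (g x) = tab_row T (g y) -> x = y) ->
  forall x, (tab_col T x < nth 0 mu (tab_row T (g x)))%N.
Proof.
move=> packing x; pose N i j0 :=
  #|[set x | tab_row T (g x) == i & (tab_col T x < j0)%N]|.
have N_eq (i : 'I_n) j0 : (j0 <= n)%N -> N i j0 = minn (nth 0%N mu i) j0.
  move=> j0n; have le_N k := packed_le packing k j0n.
  have [_] := leqif_sum (fun k (_ : true) => leqif_eq (le_N k)).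
  by rewrite (sum_packed _ _ g j0n) eqxx => /esym/forallP/(_ i)/eqP.
set i := tab_row T (g x); set j := tab_col T x; rewrite ltnNge; apply/negP=> mu_j.
have := N_eq i j.+1 (ltn_ord j); rewrite /N (cardsD1 x) !inE eqxx ltnSn /=.
rewrite (minn_idPl (leqW mu_j)) => NS.
suff : (nth 0 mu i < nth 0 mu i)%N by rewrite ltnn.
rewrite -{2}NS add1n ltnS.
rewrite -{1}(minn_idPl mu_j) -N_eq ?(ltnW (ltn_ord j)) //.
apply: subset_leq_card; apply/subsetP=> y; rewrite !inE => /andP[-> yj].
by rewrite ltnS (ltnW yj) !andbT; apply: contraTneq yj => ->; rewrite ltnn.
Qed.

(** [f] keeps x in its column and moves it to the row where g puts it; that box exists by
    [packing_self]. What remains of g after q preserves rows. *)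
Lemma packing_factor mu (T : tableau mu) (g : 'S_n) :
  (forall x y, tab_col T x = tab_col T y ->
     tab_row T (g x) = tab_row T (g y) -> x = y) ->
  exists q p : 'S_n, [/\ q \in col_stab T, p \in row_stab T & g = (q * p)%g].
Proof.
move=> packing; have lt_mu := packing_self packing.
pose f x := val T (Sub (tab_row T (g x), tab_col T x) (lt_mu x)).
have row_f x : tab_row T (f x) = tab_row T (g x).
  by rewrite /f /tab_row tableauK.
have col_f x : tab_col T (f x) = tab_col T x.
  by rewrite /f /tab_col tableauK.
have f_inj : injective f.
  move=> x y fxy; apply: packing; first by rewrite -col_f fxy col_f.
  by rewrite -row_f fxy row_f.
pose q := perm f_inj; exists q, (q^-1 * g)%g; split; last by rewrite mulKVg.
  by apply/col_stabP=> x; rewrite permE.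
by apply/row_stabP=> x; rewrite permM -row_f -(permE f_inj) permKV.
Qed.

End Coordinates.

(** * Young symmetrizers *)

Section YoungSymmetrizer.
Variables (F : fieldType) (n : nat).
Hypothesis two_neq0 : (1 < n)%N -> 2%:R != 0 :> F.
Hypothesis fact_neq0 : n`!%:R != 0 :> F.
Local Notation A := (galg F 'S_n).
Local Notation gelt := (gelt F).
Implicit Types (mu nu : intpart n) (g p q : 'S_n).

Lemma galg_Sym_semiprime : semiprime A.
Proof.
by apply: galg_semiprime; rewrite card_Sn.
Qed.

Definition row_sum mu (T : tableau mu) : A := \sum_(p in row_stab T) gelt p.

Definition col_sum mu (T : tableau mu) : A :=
  \sum_(q in col_stab T) (-1) ^+ odd_perm q *: gelt q.

Definition young_sym mu (T : tableau mu) : A := col_sum T * row_sum T.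

Lemma young_idemE mu (T : tableau mu) :
  young_idem F T = ((num_standard mu)%:R / n`!%:R) *: young_sym T.
Proof.
congr (_ *: _); rewrite /young_sym mulr_sumr; apply: eq_bigr => p _.
rewrite mulr_suml; apply: eq_bigr => q _.
by rewrite -scalerAl geltM.
Qed.

Lemma row_sum_absorb mu (T : tableau mu) p :
  p \in row_stab T -> gelt p * row_sum T = row_sum T.
Proof.
move=> /row_stabP pR; rewrite mulr_sumr [RHS](reindex_inj (mulgI p)) /=.
apply: eq_big => [s|s _]; last by rewrite geltM.
apply/row_stabP/row_stabP => sR x; first by rewrite permM sR pR.
by rewrite -[x](permKV p) -permM sR pR.
Qed.

Lemma col_sum_absorb mu (T : tableau mu) q :
  q \in col_stab T -> col_sum T * gelt q = (-1) ^+ odd_perm q *: col_sum T.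
Proof.
move=> /col_stabP qC; rewrite mulr_suml scaler_sumr [RHS](reindex_inj (mulIg q)) /=.
apply: eq_big => [s|s _].
  apply/col_stabP/col_stabP => sC x; first by rewrite permM qC sC.
  by rewrite -qC -permM sC.
by rewrite geltM odd_permM signr_addb scalerA mulrCA -signr_addb addbb mulr1 scalerAl.
Qed.

Lemma tperm_row_stab mu (T : tableau mu) x y :
  tab_row T x = tab_row T y -> tperm x y \in row_stab T.
Proof. by move=> rxy; apply/row_stabP => z; case: tpermP => [->|->|]. Qed.

Lemma tperm_col_stab mu (T : tableau mu) x y :
  tab_col T x = tab_col T y -> tperm x y \in col_stab T.
Proof. by move=> rxy; apply/col_stabP => z; case: tpermP => [->|->|]. Qed.

(** The transposition of x and y lies in the column group of S, and its conjugate by g in the row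
    group of T. Passing it through the product changes the sign, so the product is its own
    opposite. *)
Lemma col_row_sum_eq0 mu nu (S : tableau mu) (T : tableau nu) g x y :
  x != y -> tab_col S x = tab_col S y -> tab_row T (g x) = tab_row T (g y) ->
  col_sum S * gelt g * row_sum T = 0.
Proof.
move=> xy cxy rxy; set X := _ * _.
(* Two distinct entries force n > 1, where 2 is assumed nonzero; characteristic 2 does occur with n
   = 1. *)
have n_gt1 : (1 < n)%N.
  case: n x y xy {cxy rxy X} => [|[|m]] // x y; first by case: x.
  by rewrite !ord1.
have tg : gelt g * row_sum T = gelt (tperm x y) * (gelt g * row_sum T).
  rewrite -[in LHS](row_sum_absorb (tperm_row_stab rxy)) !mulrA -!geltM.
  by rewrite -tpermJ -conjgC.
have XN : X = - X.
  rewrite /X -mulrA [in LHS]tg [LHS]mulrA (col_sum_absorb (tperm_col_stab cxy)).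
  by rewrite odd_tperm xy expr1 scaleN1r mulNr.
apply/eqP; have /eqP := XN; rewrite -addr_eq0 -mulr2n -scaler_nat scaler_eq0.
by rewrite (negPf (two_neq0 n_gt1)).
Qed.

Lemma collision_or_packing mu nu (S : tableau mu) (T : tableau nu) g :
  col_sum S * gelt g * row_sum T = 0 \/
  forall x y, tab_col S x = tab_col S y ->
    tab_row T (g x) = tab_row T (g y) -> x = y.
Proof.
have [/existsP[x /existsP[y /and3P[xy /eqP cxy /eqP rxy]]]|nocol] :=
  boolP [exists x, exists y, [&& x != y, tab_col S x == tab_col S y
                              & tab_row T (g x) == tab_row T (g y)]].
  by left; apply: col_row_sum_eq0 xy cxy rxy.
right=> x y cxy rxy; apply/eqP; apply: contraNT nocol => xy.
by apply/existsP; exists x; apply/existsP; exists y; rewrite xy cxy rxy !eqxx.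
Qed.

(** Von Neumann's lemma: a group element either has a collision and contributes 0, or factors as q p
    and contributes the sign of q times C R. *)
Lemma col_row_sum_line mu (T : tableau mu) a :
  col_sum T * a * row_sum T \in <[young_sym T]>%VS.
Proof.
rewrite (galg_sum a) [col_sum T * _]mulr_sumr mulr_suml memv_suml // => g _.
rewrite -scalerAr -scalerAl memvZ //.
have [->|/packing_factor[q [p [qC pR ->]]]] := collision_or_packing T T g.
  exact: mem0v.
rewrite geltM mulrA (col_sum_absorb qC) -mulrA (row_sum_absorb pR) -scalerAl.
by rewrite memvZ ?memv_line.
Qed.

(** The row and column groups meet trivially, so q p = 1 only for q = p = 1. *)
Lemma young_sym1 mu (T : tableau mu) : young_sym T 1%g = 1.
Proof.
rewrite /young_sym mulr_suml sum_ffunE (bigD1 1%g) /=; last first.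
  by apply/col_stabP=> x; rewrite perm1.
rewrite odd_perm1 scale1r gelt1 mul1r sum_ffunE (bigD1 1%g) /=; last first.
  by apply/row_stabP=> x; rewrite perm1.
rewrite ffunE eqxx big1 => [|p /andP[_ /negPf p1]]; last first.
  by rewrite ffunE eq_sym p1.
rewrite addr0 big1 ?addr0 // => q /andP[/col_stabP qC q1].
rewrite -scalerAl galgZE gelt_mull mulg1 sum_ffunE big1 ?mulr0 // => p.
move=> /row_stabP pR; rewrite ffunE; case: eqP => // qp; case/eqP: q1.
apply/permP=> x; rewrite perm1; apply: (@tab_coord_inj _ _ T); last exact: qC.
by rewrite -[in RHS](permK q x) qp pR.
Qed.

Lemma young_sym_quasi_primitive mu (T : tableau mu) :
  quasi_primitive (young_sym T).
Proof.
split=> [|a].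
  by apply/eqP=> c0; have /eqP := young_sym1 T; rewrite c0 ffunE eq_sym oner_eq0.
by have := col_row_sum_line T (row_sum T * a * col_sum T);
  rewrite /young_sym !mulrA => /vlineP.
Qed.

Lemma young_sym_conj mu (T T' : tableau mu) :
  exists g, young_sym T' = gelt g^-1%g * young_sym T * gelt g.
Proof.
pose f x := val T' (box_of T x).
have f_inj : injective f.
  exact: inj_comp (@tableau_inj _ _ T') (can_inj (box_ofK T)).
pose g := perm f_inj; exists g.
have rowg x : tab_row T' (g x) = tab_row T x by rewrite permE /tab_row tableauK.
have colg x : tab_col T' (g x) = tab_col T x by rewrite permE /tab_col tableauK.
have conj_gelt h : gelt (h ^ g)%g = gelt g^-1%g * gelt h * gelt g.
  by rewrite -!geltM conjgE mulgA.
rewrite /young_sym; have -> : row_sum T' = gelt g^-1%g * row_sum T * gelt g.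
  rewrite mulr_sumr mulr_suml [LHS](reindex_inj (conjg_inj g)) /=.
  apply: eq_big => [p|p _]; last exact: conj_gelt.
  apply/row_stabP/row_stabP => pR x; first by rewrite -!rowg -permJ pR.
  by rewrite -[x](permKV g) permJ !rowg pR.
have -> : col_sum T' = gelt g^-1%g * col_sum T * gelt g.
  rewrite mulr_sumr mulr_suml [LHS](reindex_inj (conjg_inj g)) /=.
  apply: eq_big => [p|p _].
    apply/col_stabP/col_stabP => pR x; first by rewrite -!colg -permJ pR.
    by rewrite -[x](permKV g) permJ !colg pR.
  by rewrite odd_permJ -scalerAr -scalerAl conj_gelt.
by rewrite !mulrA -(mulrA _ (gelt g)) -geltM mulgV gelt1 mulr1.
Qed.

(** A nonzero product needs a packing, hence dominance in a fixed direction, and distinct shapes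
    cannot dominate each other both ways. *)
Lemma young_sym_ortho mu nu : mu <> nu ->
  (forall (S : tableau mu) (T : tableau nu) a, young_sym S * a * young_sym T = 0) \/
  (forall (S : tableau nu) (T : tableau mu) a, young_sym S * a * young_sym T = 0).
Proof.
have ortho m1 m2 : (forall (S : tableau m1) (T : tableau m2) a,
    young_sym S * a * young_sym T = 0) \/ forall j, (j <= n)%N ->
    (\sum_(i < n) minn (nth 0 m1 i) j <= \sum_(i < n) minn (nth 0 m2 i) j)%N.
  have [/forallP dom|] := boolP [forall j : 'I_n.+1,
    (\sum_(i < n) minn (nth 0 m1 i) j <= \sum_(i < n) minn (nth 0 m2 i) j)%N].
    by right=> j j_n; apply: (dom (Ordinal (j_n : (j < n.+1)%N))).
  rewrite negb_forall => /existsP[j ndom]; left=> S T a.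
  have zero b : col_sum S * b * row_sum T = 0.
    rewrite (galg_sum b) [col_sum S * _]mulr_sumr mulr_suml big1 // => g _.
    rewrite -scalerAr -scalerAl.
    have [->|packing] := collision_or_packing S T g; first by rewrite scaler0.
    by rewrite (packing_dominance packing) // -ltnS in ndom.
  have -> : young_sym S * a * young_sym T
      = col_sum S * (row_sum S * a * col_sum T) * row_sum T.
    by rewrite /young_sym !mulrA.
  exact: zero.
move=> neq; have [|dom12] := ortho mu nu; first by left.
have [|dom21] := ortho nu mu; first by right.
by case: neq; apply: sum_minn_inj => j jn; apply/eqP; rewrite eqn_leq dom12 ?dom21.
Qed.

End YoungSymmetrizer.

(** * A Vandermonde identity *)

Section VandermondeShift.
Variables (F : fieldType) (k : nat).
Implicit Types x y : 'I_k -> F.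

Definition vdm x : 'M[F]_k := \matrix_(i, j) x i ^+ j.

Lemma det_vdm x : \det (vdm x) = \prod_(i < k) \prod_(j < k | (i < j)%N) (x j - x i).
Proof.
rewrite -det_tr.
have -> : (vdm x)^T = Vandermonde k (\row_j x j).
  by apply/matrixP=> i j; rewrite !mxE.
by rewrite det_Vandermonde; under eq_bigr do under eq_bigr do rewrite !mxE.
Qed.

Lemma det_vdm_eq0 x i j : i != j -> x i = x j -> \det (vdm x) = 0.
Proof.
by move=> ij xij; apply: determinant_alternate ij _ => r; rewrite !mxE xij.
Qed.

Definition shift x (i : 'I_k) : 'I_k -> F := fun j => x j - (j == i)%:R.

(** Gives the diagonal of [U] in [sum_det_vdm_shift]. At j = 0 the truncated predecessor reads the
    constant coefficient 1, whence the first term. *)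
Lemma coef_expXsub1 j : (('X - 1%:P : {poly F}) ^+ j)`_j.-1 = (j == 0)%:R - j%:R.
Proof.
case: j => [|j]; first by rewrite expr0 coefC subr0.
have := @coefPn_prod_XsubC F (nseq j.+1 1); rewrite size_nseq.
rewrite !big_nseq iter_mulr_1 iter_addr_0 => ->//.
by rewrite sub0r.
Qed.

(* The matrix with rows x_i (x_i - 1)^j is vdm x *m U, where column j of U holds
   the coefficients of 'X ('X - 1)^j reduced modulo prod_i ('X - x_i); only
   j = k - 1 needs reducing. *)
Lemma sum_det_vdm_shift x :
  \sum_i x i * \det (vdm (shift x i)) =
  (\sum_i x i - \sum_(j < k) j%:R) * \det (vdm x).
Proof.
pose P : {poly F} := \prod_(i < k) ('X - (x i)%:P).
pose q (j : 'I_k) : {poly F} :=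
  'X * ('X - 1%:P) ^+ j - (if j.+1 == k then P else 0).
pose M : 'M[F]_k := \matrix_(i, j) (x i * (x i - 1) ^+ j).
pose U : 'M[F]_k := \matrix_(r, j) (q j)`_r.
have sizeP : size P = k.+1.
  by rewrite size_prod_XsubC -[index_enum _]enumT size_enum_ord.
have size_q j : (size (q j) <= k)%N.
  have size_X : size (('X : {poly F}) * ('X - 1%:P) ^+ j) = j.+2.
    by rewrite mulrC size_mulX ?size_exp_XsubC // expf_neq0 // polyXsubC_eq0.
  rewrite /q; case: ifP => [/eqP jk|/negbT jk].
    apply/leq_sizeP => r; rewrite leq_eqVlt => /predU1P[<-|kr].
      rewrite coefB; have -> : P`_k = 1.
        have := monic_prod_XsubC (index_enum 'I_k) xpredT x.
        by rewrite monicE lead_coefE -/P sizeP => /eqP.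
      have : 'X * ('X - 1%:P) ^+ j \is @monic F.
        by rewrite monicMr ?monicX // monic_exp // monicXsubC.
      by rewrite monicE lead_coefE size_X /= jk => /eqP ->; rewrite subrr.
    by rewrite coefB !nth_default ?subr0 ?sizeP // size_X jk.
  by rewrite subr0 size_X ltn_neqAle jk ltn_ord.
have MVU : M = vdm x *m U.
  apply/matrixP=> i j; rewrite !mxE.
  have -> : x i * (x i - 1) ^+ j = (q j).[x i].
    rewrite /q; have Px : P.[x i] = 0.
      by apply/rootP; rewrite /P (bigD1 i) //= rootM root_XsubC eqxx.
    by case: ifP => _; rewrite !(hornerE, horner_exp) ?Px ?subr0.
  rewrite (horner_coef_wide _ (size_q j)); apply: eq_bigr => r _.
  by rewrite !mxE mulrC.
(* Shifting x i changes only row i, so expansion along that row uses the cofactors of [vdm x]; the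
   sum over i is then a trace, equal to the determinant times the trace of [U]. *)
have detM i : x i * \det (vdm (shift x i)) = \sum_j M i j * \adj (vdm x) j i.
  rewrite (expand_det_row _ i) mulr_sumr; apply: eq_bigr => j _.
  rewrite !mxE /shift eqxx mulrA; congr (_ * _).
  congr (_ * \det _); apply/matrixP=> r s; rewrite !mxE.
  by rewrite eq_sym (negPf (neq_lift i r)) subr0.
have -> : \sum_i x i * \det (vdm (shift x i)) = \tr (M *m \adj (vdm x)).
  by apply: eq_bigr => i _; rewrite detM mxE.
rewrite MVU -mulmxA mxtrace_mulC -mulmxA mul_adj_mx mul_mx_scalar mxtraceZ mulrC.
congr (_ * _); rewrite /mxtrace.
have Uj (j : 'I_k) : U j j = - j%:R + (if j.+1 == k then \sum_i x i else 0).
  rewrite mxE /q coefB coefXM; congr (_ + _).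
    case: j => [[|j] jk] /=; first by rewrite oppr0.
    by rewrite (coef_expXsub1 j.+1) sub0r.
  case: ifP => [/eqP jk|_]; last by rewrite coefC if_same oppr0.
  have := @coefPn_prod_XsubC F [seq x i | i <- index_enum 'I_k].
  rewrite size_map -[index_enum _]enumT size_enum_ord enumT !big_map -(congr1 predn jk) /= => -> //.
    by rewrite opprK.
  by rewrite -lt0n (leq_ltn_trans _ (ltn_ord j)).
rewrite (eq_bigr _ (fun j _ => Uj j)) big_split /= sumrN addrC; congr (_ - _).
case: k x {P q M U sizeP size_q MVU detM Uj} => [|m] x; first by rewrite !big_ord0.
by rewrite big_ord_recr /= eqxx big1 ?add0r // => i _; rewrite eqSS ltn_eqF.
Qed.

End VandermondeShift.

(** * Standard tableaux as linear extensions *)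

Section LinearExtensions.
Variables (X : finType) (before : rel X).
Hypothesis before_irr : irreflexive before.
Implicit Types (D : {set X}) (c d : X).

(* The largest element comes first. *)
Definition lin_ext t D : {set t.-tuple X} :=
  [set s : t.-tuple X |
     [&& uniq s, [set c in s] == D & pairwise (fun c d => ~~ before c d) s]].

Definition maximal_in D c := (c \in D) && [forall d in D, ~~ before c d].

Lemma lin_ext_cons t D c (s : t.-tuple X) :
  ([tuple of c :: s] \in lin_ext t.+1 D)
  = maximal_in D c && (s \in lin_ext t (D :\ c)).
Proof.
rewrite !inE /=; apply/and3P/andP.
  case=> /andP[cs us] /eqP <- /andP[/allP cmax ps]; split.
    rewrite /maximal_in !inE eqxx /=; apply/forall_inP => d.
    by rewrite !inE => /predU1P[->|/cmax //]; rewrite before_irr.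
  rewrite us ps andbT /=; apply/eqP/setP=> d; rewrite !inE.
  by case: eqP => [->|//]; apply/negbTE.
case=> /andP[cD /forall_inP cmax] /and3P[us /eqP sD ps].
have sE d : (d \in tval s) = (d != c) && (d \in D).
  by have /setP/(_ d) := sD; rewrite !inE.
split.
- by rewrite us sE eqxx.
- by apply/eqP/setP=> d; rewrite !inE sE; case: eqP => [->|].
by rewrite ps andbT; apply/allP => d; rewrite sE => /andP[_ /cmax].
Qed.

Lemma card_lin_extS t D :
  #|lin_ext t.+1 D| = (\sum_(c | maximal_in D c) #|lin_ext t (D :\ c)|)%N.
Proof.
rewrite -sum1_card (partition_big (fun s : t.+1.-tuple X => thead s)
  (maximal_in D)) /= => [|s]; last first.
  by case/tupleP: s => c s; rewrite lin_ext_cons theadE => /andP[].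
apply: eq_bigr => c cmax.
rewrite -(card_imset _ (f := fun s : t.-tuple X => [tuple of c :: s])); last first.
  by move=> s s' /(congr1 val) [ss']; apply: val_inj.
rewrite -sum1_card; apply: eq_bigl => s; case/tupleP: s => d s.
rewrite lin_ext_cons theadE; apply/idP/imsetP.
  by case/andP=> /andP[_ sD] /eqP <-; exists s.
case=> s' s'D /(congr1 val) [-> ss']; rewrite eqxx andbT cmax.
by rewrite (val_inj ss' : s = s').
Qed.

Lemma card_lin_ext0 : #|lin_ext 0 set0| = 1%N.
Proof.
apply/eqP/cards1P; exists [tuple]; apply/setP=> s.
have -> : s \in [set [tuple]] by rewrite inE [s]tuple0.
by rewrite inE [s]tuple0 /= andbT; apply/eqP/setP=> c; rewrite !inE.
Qed.

End LinearExtensions.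

Section StandardTableaux.
Variables (n : nat) (mu : intpart n).

Definition box_before (c d : cell mu) :=
  ((row_of c == row_of d) && (col_of c < col_of d)%N)
  || ((col_of c == col_of d) && (row_of c < row_of d)%N).

Lemma box_before_irr : irreflexive box_before.
Proof. by move=> c; rewrite /box_before !ltnn !andbF. Qed.

Lemma standardP (T : tableau mu) :
  reflect (forall c d, box_before c d -> (val T c < val T d)%N) (standard T).
Proof.
apply: (iffP forallP) => [st c d|st c].
  have /forallP/(_ d)/andP[/implyP r /implyP k] := st c.
  by case/orP=> [/r|/k].
apply/forallP=> d; apply/andP; split; apply/implyP=> cd; apply: st.
  by rewrite /box_before cd.
by rewrite /box_before cd orbT.
Qed.

(** [rev_ord] lists the boxes from the largest entry down, as in [lin_ext]. *)
Definition reading (T : tableau mu) : n.-tuple (cell mu) :=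
  [tuple box_of T (rev_ord i) | i < n].

Lemma reading_inj : injective reading.
Proof.
move=> T T' eqT; apply/val_inj/ffunP => c.
have := congr1 (@tnth _ _ ^~ (rev_ord (val T c))) eqT; rewrite /= !tnth_mktuple rev_ordK tableauK.
by move=> cE; rewrite [in RHS]cE box_ofK.
Qed.

Lemma num_standardE : num_standard mu = #|lin_ext box_before n [set: cell mu]|.
Proof.
rewrite /num_standard -(card_imset _ reading_inj); apply: eq_card => s.
apply/imsetP/idP => [[T Tst ->]|].
  rewrite !inE; apply/and3P; split.
  - rewrite map_inj_uniq ?enum_uniq // => i j /(can_inj (box_ofK T)).
    exact: rev_ord_inj.
  - apply/eqP/setP=> c; rewrite !inE; apply/mapP.
    exists (rev_ord (val T c)); first by rewrite mem_enum.
    by rewrite rev_ordK tableauK.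
  rewrite pairwise_map.
  have : pairwise (fun i j : 'I_n => (i < j)%N) (enum 'I_n).
    by rewrite -(pairwise_map val ltn) val_enum_ord -sorted_pairwise ?iota_ltn_sorted //;
      apply: ltn_trans.
  apply: sub_pairwise => i j ij; apply/negP => /(standardP _ Tst).
  by rewrite !box_ofK /=; apply/negP; rewrite -leqNgt leq_sub2l // ltnW.
rewrite !inE => /and3P[us /eqP sT ps].
have s_in c : c \in tval s by have /setP/(_ c) := sT; rewrite !inE.
have idx c : (index c s < n)%N.
  by have := s_in c; rewrite -index_mem size_tuple.
pose f := [ffun c => rev_ord (Ordinal (idx c))].
have f_inj : injectiveb f.
  apply/injectiveP=> c d; rewrite !ffunE => /rev_ord_inj/(congr1 val) /= cd.
  by rewrite -(nth_index c (s_in c)) cd nth_index.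
exists (Sub f f_inj : tableau mu).
  apply/standardP => c d cd; rewrite !ffunE /= ltn_sub2lE ?idx // ltnS.
  rewrite ltnNge; apply/negP; rewrite leq_eqVlt => /predU1P[eqi|lti].
    move: cd; have -> : c = d by rewrite -[LHS](nth_index c (s_in c)) eqi nth_index.
    by rewrite box_before_irr.
  have /(pairwiseP c)/(_ (index c s) (index d s)) := ps.
  by rewrite !inE !index_mem !s_in !nth_index // cd; move/(_ isT isT lti).
apply: eq_from_tnth => i; rewrite tnth_mktuple.
set T : tableau mu := Sub _ _; apply: (@tableau_inj _ _ T).
rewrite box_ofK /= ffunE; congr rev_ord; apply: val_inj => /=.
by rewrite (tnth_nth (tnth s i)) index_uniq ?size_tuple.
Qed.

End StandardTableaux.

(** * Frobenius' formula *)

Section Frobenius.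
Variables (n : nat) (mu : intpart n).
Implicit Type nu : nat -> nat.
Local Notation k := (size mu).

(** Row lengths form a bare function so that a box is removed by subtraction; k stays the number of
    rows of mu, so all determinants keep one size even when rows become empty. *)
Definition subdiagram nu :=
  (forall i, (nu i <= nth 0 mu i)%N) /\ (forall i, (nu i.+1 <= nu i)%N).

Definition diagram nu : {set cell mu} :=
  [set c : cell mu | (col_of c < nu (row_of c))%N].

Definition remove_box nu (i : nat) : nat -> nat := fun j => (nu j - (j == i))%N.

Lemma subdiagram_le nu i j : subdiagram nu -> (i <= j)%N -> (nu j <= nu i)%N.
Proof.
move=> [_ nu_anti] /subnK <-; elim: (j - i)%N => [|m IH] //.
by rewrite addSn (leq_trans (nu_anti _)).
Qed.

Lemma subdiagram_remove nu i :
  subdiagram nu -> (nu i.+1 < nu i)%N -> subdiagram (remove_box nu i).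
Proof.
move=> [nu_mu nu_anti] corner; split=> j; rewrite /remove_box.
  by rewrite (leq_trans (leq_subr _ _)).
case: (j =P i) => [->|_].
  by rewrite (leq_trans (leq_subr _ _)) // leq_subRL; lia.
by rewrite subn0 (leq_trans (leq_subr _ _)).
Qed.

Lemma maximal_diagram nu (c : cell mu) : subdiagram nu ->
  maximal_in (@box_before n mu) (diagram nu) c =
  (nu (row_of c).+1 < nu (row_of c))%N && (nu (row_of c) == (col_of c).+1).
Proof.
move=> nuP; have [nu_mu nu_anti] := nuP.
rewrite /maximal_in inE; apply/andP/andP => [[c_nu /forall_inP cmax]|[lt /eqP eqc]].
  have cE : nu (row_of c) = (col_of c).+1.
    apply/eqP; rewrite eqn_leq c_nu andbT leqNgt; apply/negP => lt.
    have lt_mu : ((col_of c).+1 < nth 0 mu (row_of c))%N by apply: leq_trans (nu_mu _).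
    have lt_n : ((col_of c).+1 < n)%N by apply: leq_trans lt_mu (nth_intpart_le _ _).
    pose d : cell mu := Sub (row_of c, Ordinal lt_n) lt_mu.
    have /cmax : d \in diagram nu by rewrite inE.
    by rewrite /box_before /= eqxx ltnSn.
  split; last by apply/eqP.
  rewrite ltnNge cE; apply/negP => lt.
  have lt_mu : (col_of c < nth 0 mu (row_of c).+1)%N by apply: leq_trans (nu_mu _).
  have lt_n : ((row_of c).+1 < n)%N.
    by apply: leq_trans (size_intpart mu); rewrite -nth_intpart_size (leq_ltn_trans _ lt_mu).
  pose d : cell mu := Sub (Ordinal lt_n, col_of c) lt_mu.
  have /cmax : d \in diagram nu by rewrite inE.
  by rewrite /box_before /= eqxx ltnSn orbT.
split; first by rewrite eqc.
apply/forall_inP => d; rewrite inE => d_nu; apply/negP => /orP[]/andP[/eqP e lt'].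
  by move: d_nu; rewrite -e eqc ltnS leqNgt lt'.
have := subdiagram_le nuP lt'; move: lt d_nu; rewrite -e eqc.
by lia.
Qed.

Lemma card_lin_ext_diagram t nu : subdiagram nu ->
  #|lin_ext (@box_before n mu) t.+1 (diagram nu)| =
  (\sum_(i < k | (nu i.+1 < nu i)%N)
     #|lin_ext (@box_before n mu) t (diagram (remove_box nu i))|)%N.
Proof.
move=> nuP; have [nu_mu _] := nuP.
rewrite card_lin_extS; last exact: box_before_irr.
rewrite (partition_big (@row_of n mu) xpredT) //=.
rewrite (big_ord_widen_cond n (fun i => nu i.+1 < nu i)%N
  (fun i => #|lin_ext (@box_before n mu) t (diagram (remove_box nu i))|)); last first.
  exact: size_intpart.
rewrite [RHS]big_mkcond; apply: eq_bigr => i _.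
have -> : (nu i.+1 < nu i)%N && (i < k)%N = (nu i.+1 < nu i)%N.
  apply: andb_idr => lt; rewrite -nth_intpart_size (leq_trans _ (nu_mu i)) //.
  exact: leq_ltn_trans lt.
case: ifP => [lt|nlt]; last first.
  rewrite big_pred0 // => c; rewrite maximal_diagram //.
  by case: (row_of c =P i) => [->|]; rewrite ?andbF ?nlt.
have nu_i : ((nu i).-1.+1 = nu i)%N by rewrite prednK // (leq_ltn_trans _ lt).
have lt_mu : ((nu i).-1 < nth 0 mu i)%N by rewrite nu_i nu_mu.
have lt_n : ((nu i).-1 < n)%N by apply: leq_trans lt_mu (nth_intpart_le _ _).
pose c0 : cell mu := Sub (i, Ordinal lt_n) lt_mu.
rewrite (big_pred1 c0) => [|c]; last first.
  rewrite maximal_diagram //; apply/andP/eqP => [[/andP[_ /eqP cE] /eqP ri]|->].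
    apply/val_inj; rewrite /= [val c]surjective_pairing; congr (_, _) => //.
    by apply: val_inj => /=; rewrite -ri cE.
  by rewrite /= eqxx lt nu_i eqxx.
congr #|pred_of_set (lin_ext _ _ _)|; apply/setP=> c; rewrite !inE /remove_box.
have -> : (c == c0) = (row_of c == i) && (col_of c == (nu i).-1 :> nat).
  by rewrite -val_eqE /= -pair_eqE.
by rewrite -(inj_eq val_inj (row_of c)) /=; case: eqP => [->|_] /=; lia.
Qed.

Section Field.
Variable F : fieldType.

(** The beta-numbers of nu; for a shape with exactly k nonempty rows they are the hook lengths of
    the first column. *)
Definition beta nu (i : 'I_k) : nat := (nu i + (k - i.+1))%N.

Local Notation delta nu := (\det (vdm (fun i => (beta nu i)%:R : F))).
Local Notation zero := (fun=> 0%N).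

(* Frobenius' identity d_nu * prod_i beta_i! = t! * Delta(beta), multiplied by its
   instance for the empty diagram so that the induction starts trivially. *)
Lemma frobenius_formula t nu : subdiagram nu -> (\sum_(i < k) nu i = t)%N ->
  #|lin_ext (@box_before n mu) t (diagram nu)|%:R
    * (\prod_(i < k) (beta nu i)`!)%:R * delta zero
  = (\prod_(i < k) (beta zero i)`!)%:R * t`!%:R * delta nu.
Proof.
elim: t nu => [|t IH] nu nuP sum_nu.
  have nu0 (i : 'I_k) : nu i = 0%N.
    by apply/eqP; rewrite -leqn0 -sum_nu (bigD1 i) //= leq_addr.
  have -> : diagram nu = set0.
    apply/setP=> c; rewrite !inE; apply/negbTE; rewrite -leqNgt.
    have [rk|kr] := ltnP (row_of c) k; first by rewrite (nu0 (Ordinal rk)).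
    by have := nuP.1 (row_of c); rewrite (nth_default _ kr) leqn0 => /eqP->.
  rewrite card_lin_ext0 fact0 mul1r mulr1.
  have beta0 i : beta nu i = beta zero i by rewrite /beta nu0.
  congr (_ * _); first by congr _%:R; apply: eq_bigr => i _; rewrite beta0.
  by congr (\det _); apply/matrixP=> i j; rewrite !mxE beta0.
rewrite card_lin_ext_diagram // natr_sum !mulr_suml.
pose x (i : 'I_k) : F := (beta nu i)%:R.
pose K : F := (\prod_(i < k) (beta zero i)`!)%:R * t`!%:R.
have beta_remove (i j : 'I_k) : (nu i.+1 < nu i)%N ->
    beta (remove_box nu i) j = (beta nu j - (j == i))%N.
  move=> lt; rewrite /beta /remove_box -(inj_eq val_inj j).
  by case: eqP => [->|]; lia.
(* Removing a box from row i lowers one beta-number by 1, which is [shift]; the factor x i comes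
   from b! = b (b - 1)! for that beta-number b. *)
transitivity (\sum_(i < k) x i * (K * \det (vdm (shift x i)))); last first.
  under eq_bigr => i _ do rewrite mulrCA.
  rewrite -mulr_sumr sum_det_vdm_shift /K factS natrM !mulrA.
  congr (_ * _); rewrite -!mulrA; congr (_ * _); rewrite mulrC; congr (_ * _).
  rewrite -sum_nu natr_sum [X in _ - X](reindex_inj rev_ord_inj) /= -sumrB.
  by apply: eq_bigr => i _; rewrite /x /beta natrD addrK.
rewrite big_mkcond; apply: eq_bigr => i _; case: ifP => [lt|nlt].
  rewrite (_ : (\prod_(j < k) (beta nu j)`!)%N
             = (beta nu i * \prod_(j < k) (beta (remove_box nu i) j)`!)%N).
    rewrite natrM mulrCA -[LHS]mulrA; congr (_ * _); rewrite IH.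
    - congr (_ * _); congr (\det _); apply/matrixP=> r s; rewrite !mxE /shift /x beta_remove //.
      congr (_ ^+ _); rewrite natrB //; case: eqP => // ->.
      by rewrite /beta; lia.
    - exact: subdiagram_remove.
    apply: succn_inj; rewrite -sum_nu (bigD1 i) //= [RHS](bigD1 i) //=.
    rewrite /remove_box eqxx -addSn; congr (_ + _)%N; first by lia.
    by apply: eq_bigr => j ji; rewrite (inj_eq val_inj) (negPf ji) subn0.
  rewrite (bigD1 i) //= [in RHS](bigD1 i) //= mulnA; congr (_ * _)%N.
    rewrite beta_remove // eqxx -[in LHS](@prednK (beta nu i)) ?factS ?prednK ?subn1 //;
      by rewrite /beta; lia.
  by apply: eq_bigr => j ji; rewrite beta_remove // (negPf ji) subn0.
(* Row i is not a corner, so its term must vanish: the lowered beta-number coincides with the next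
   one, or, in the last row, x i is already 0. *)
apply/esym; have nu_i : nu i.+1 = nu i.
  by apply/eqP; rewrite eqn_leq nuP.2 leqNgt nlt.
have [ik|ki] := ltnP i.+1 k.
  rewrite (@det_vdm_eq0 _ _ _ i (Ordinal ik)) ?mulr0 //.
    by rewrite -val_eqE /= neq_ltn ltnSn.
  rewrite /shift eqxx (_ : Ordinal ik == i = false).
    rewrite subr0 /x -natrB; last by rewrite /beta; lia.
    by congr _%:R; rewrite /beta /= nu_i; lia.
  by apply/negbTE; rewrite -val_eqE /= neq_ltn ltnSn orbT.
have nu0 : nu i = 0%N.
  by apply/eqP; rewrite -nu_i -leqn0 (leq_trans (nuP.1 _)) // nth_default.
by rewrite /x /beta nu0 add0n (_ : k - i.+1 = 0)%N ?mul0r //; lia.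
Qed.

Hypothesis fact_neq0 : n`!%:R != 0 :> F.

Lemma natr_neq0 m : (0 < m <= n)%N -> m%:R != 0 :> F.
Proof.
move=> /dvdn_fact/dvdnP[q nE]; apply: contraNneq fact_neq0 => m0.
by rewrite nE natrM m0 mulr0.
Qed.

Lemma fact_le_neq0 m : (m <= n)%N -> m`!%:R != 0 :> F.
Proof.
move=> mn; apply: contraNneq fact_neq0 => m0.
by rewrite (fact_split mn) natrM m0 mul0r.
Qed.

(** Each of the other k - 1 rows has a box. The bound keeps the beta-numbers of mu at most n, so
    that their differences are nonzero in F. *)
Lemma hook_le (i : 'I_k) : (nth 0 mu i + k.-1 <= n)%N.
Proof.
have /and3P[_ mu_pos /eqP sum_mu] := partsP mu.
rewrite -[leqRHS]sum_mu sumnE (big_nth 0%N) big_mkord (bigD1 i) //= leq_add2l.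
have <- : #|predC1 i| = k.-1 by rewrite cardC1 card_ord.
by rewrite -sum1_card leq_sum // => j _; rewrite nth_intpart_size.
Qed.

(** Were the count zero in F, the right side of [frobenius_formula] would vanish; but its factors
    are factorials of numbers at most n and differences of distinct beta-numbers. *)
Lemma num_standard_neq0 : (num_standard mu)%:R != 0 :> F.
Proof.
have muP : subdiagram (nth 0%N mu).
  split=> // i; have /and3P[mu_sorted _ _] := partsP mu.
  have [ik|ki] := ltnP i.+1 k; last by rewrite nth_default.
  have geq_trans : transitive geq by move=> a b c ba cb; apply: leq_trans ba.
  by apply: (sorted_ltn_nth geq_trans) => //; rewrite inE // ltnW.
have sum_mu : (\sum_(i < k) nth 0 mu i = n)%N.
  have /and3P[_ _ /eqP sum_mu] := partsP mu.
  by rewrite -[RHS]sum_mu sumnE (big_nth 0%N) big_mkord.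
have := frobenius_formula muP sum_mu.
have -> : diagram (nth 0%N mu) = [set: cell mu].
  by apply/setP=> c; rewrite !inE (valP c).
rewrite -num_standardE; apply: contra_eqN => /eqP ->; rewrite !mul0r eq_sym.
have beta_le i : (beta (nth 0%N mu) i <= n)%N.
  apply: leq_trans (hook_le i); rewrite /beta leq_add2l -subn1 leq_sub2l //.
rewrite !mulf_neq0 //.
  rewrite natr_prod; apply/prodf_neq0 => i _; apply: fact_le_neq0.
  by apply: leq_trans (size_intpart mu); rewrite /beta add0n leq_subr.
rewrite det_vdm; apply/prodf_neq0 => i _; apply/prodf_neq0 => j ij.
have lt : (beta (nth 0%N mu) j < beta (nth 0%N mu) i)%N.
  have := subdiagram_le muP (ltnW ij); rewrite /beta; have := ltn_ord j; lia.
rewrite -opprB oppr_eq0 -natrB ?(ltnW lt) // natr_neq0 //.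
by rewrite subn_gt0 lt (leq_trans (leq_subr _ _)).
Qed.

End Field.
End Frobenius.

(** * Wedderburn components *)

Lemma transpose_tableau n (mu : intpart n) (T : tableau mu) :
  exists T' : tableau (conj_intpart mu),
    forall x, tab_row T' x = tab_col T x /\ tab_col T' x = tab_row T x.
Proof.
have swapP (c : cell (conj_intpart mu)) : (row_of c < nth 0 mu (col_of c))%N.
  by have := valP c; rewrite /= conj_intpartP.
pose swap c : cell mu := Sub (col_of c, row_of c) (swapP c).
have swap_inj : injective swap.
  move=> c d /(congr1 val) [ecol erow]; apply: val_inj.
  by move: ecol erow; rewrite /col_of /row_of;
    case: (val c) (val d) => [i j] [i' j'] /= -> ->.
have T'_inj : injectiveb [ffun c => val T (swap c)].
  by apply/injectiveP=> c d; rewrite !ffunE => /tableau_inj/swap_inj.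
exists (Sub [ffun c => val T (swap c)] T'_inj) => x.
set T' : tableau _ := Sub _ _.
have box_swap : box_of T x = swap (box_of T' x).
  have {1}-> : x = val T (swap (box_of T' x)).
    by rewrite -{1}[x](box_ofK T') /= ffunE.
  by rewrite tableauK.
by rewrite /tab_row /tab_col box_swap.
Qed.

Section SignTwist.
Variables (F : fieldType) (n : nat).
Local Notation A := (galg F 'S_n).

Definition sign_twist (a : A) : A := [ffun g : 'S_n => (-1) ^+ odd_perm g * a g].

Fact sign_twist_is_linear : linear sign_twist.
Proof.
by move=> k a b; apply/ffunP=> g; rewrite !ffunE mulrDr mulrCA.
Qed.

HB.instance Definition _ := GRing.isSemilinear.Build F A A _ sign_twist
  (GRing.semilinear_linear sign_twist_is_linear).

Lemma sign_twistM : {morph sign_twist : a b / a * b}.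
Proof.
move=> a b; apply/ffunP=> g; rewrite ffunE !galgME mulr_sumr.
apply: eq_bigr => h _; rewrite !ffunE -{1}(mulKVg h g) odd_permM signr_addb.
by rewrite mulrACA.
Qed.

Lemma sign_twistK : involutive sign_twist.
Proof. by move=> a; apply/ffunP=> g; rewrite !ffunE signrMK. Qed.

Lemma sign_twist_gelt (g : 'S_n) :
  sign_twist (gelt F g) = (-1) ^+ odd_perm g *: gelt F g.
Proof.
by apply/ffunP=> h; rewrite galgZE !ffunE; case: eqP => [->|]; rewrite ?mulr0.
Qed.

(** The coefficient of a fixed element at an odd permutation is its own opposite, hence 0 when 2 is
    invertible. *)
Lemma alt_algP : 2%:R != 0 :> F ->
  forall a : A, reflect (sign_twist a = a) (a \in alt_alg F n).
Proof.
move=> two a; apply: (iffP idP) => [aB|aE].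
  apply/eqP; rewrite -subr_eq0 -memv0.
  have tE b : (linfun sign_twist - \1)%VF b = sign_twist b - b.
    by rewrite add_lfunE opp_lfunE id_lfunE lfunE.
  rewrite -tE memv_preim; apply: subvP a aB; apply/span_subvP => b.
  case/imageP=> g; rewrite Alt_even => gA ->; rewrite -memv_preim tE memv0.
  by rewrite sign_twist_gelt (negPf gA) scale1r subrr.
rewrite (galg_sum a) memv_suml // => g _.
have [g_odd|g_even] := boolP (odd_perm g); last first.
  by rewrite memvZ // memv_span // image_f // Alt_even.
have /ffunP/(_ g) := aE; rewrite ffunE g_odd expr1 mulN1r => /eqP.
rewrite eq_sym -addr_eq0 -mulr2n -mulr_natl mulf_eq0 (negPf two) => /eqP ->.
by rewrite scale0r mem0v.
Qed.

End SignTwist.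

Section Components.
Variables (F : fieldType) (n : nat).
Hypothesis two_neq0 : (1 < n)%N -> 2%:R != 0 :> F.
Hypothesis fact_neq0 : n`!%:R != 0 :> F.
Hypothesis num_standard_neq0 :
  forall mu : intpart n, (num_standard mu)%:R != 0 :> F.
Local Notation A := (galg F 'S_n).
Implicit Types (mu nu : intpart n).

Let ASP : semiprime A := galg_Sym_semiprime fact_neq0.

Let c_prim mu (T : tableau mu) : quasi_primitive (young_sym F T).
Proof. exact: young_sym_quasi_primitive. Qed.

Let J mu (T : tableau mu) := ({:A} * <[young_sym F T]> * {:A})%VS.

(** Here the nonvanishing of d_mu in F enters: otherwise [young_idem] would be 0 and could not
    single out an ideal. *)
Lemma young_idem_line mu (T : tableau mu) : <[young_idem F T]>%VS = <[young_sym F T]>%VS.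
Proof.
rewrite young_idemE; set k := _ / _.
have k0 : k != 0 by rewrite mulf_neq0 ?invr_neq0.
apply/eqP; rewrite eqEsubv -!memvE memvZ ?memv_line //=.
by apply/vlineP; exists k^-1; rewrite scalerA mulVf ?scale1r.
Qed.

(** Tableaux of one shape have conjugate symmetrizers, so the ideal built from one of them contains
    all the others. *)
Lemma sym_component_eq mu (T : tableau mu) : sym_component F mu = J T.
Proof.
have youngJ (T' : tableau mu) : young_sym F T' \in J T.
  by have [g ->] := young_sym_conj F T T'; apply: mem_ideal_line.
apply: classical_sets.xget_unique.
  split=> [|T']; first exact: minimal_ideal_line.
  by rewrite young_idemE memvZ ?youngJ.
move=> K [Kmin KT]; have Jmin := minimal_ideal_line ASP (c_prim T).
apply: (minimal_ideal_eq Kmin Jmin (c_prim T).1).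
  by have := KT T; rewrite memvE young_idem_line -memvE.
exact: youngJ.
Qed.

Lemma sym_idem_eq mu (T : tableau mu) eps : eps \in J T ->
    (forall x, eps * x = x * eps) -> eps * young_sym F T = young_sym F T ->
  sym_idem F mu = eps.
Proof.
move=> epsJ epsC epsc.
have epsl := ideal_line_unit epsC epsc.
rewrite /sym_idem (sym_component_eq T); apply: classical_sets.xget_unique.
  split=> // [|x xJ]; last by rewrite -epsC epsl.
  by apply: contraNneq (c_prim T).1 => eps0; rewrite -epsc eps0 mul0r.
move=> e [eJ _ eP]; have [<- _] := eP eps epsJ.
by rewrite -epsC epsl.
Qed.

Lemma sym_idemP mu (T : tableau mu) :
  [/\ sym_idem F mu \in J T, forall x, sym_idem F mu * x = x * sym_idem F mu
    & sym_idem F mu * young_sym F T = young_sym F T].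
Proof.
have c1 : young_sym F T 1%g != 0 by rewrite young_sym1 oner_eq0.
have card0 : #|('S_n : finGroupType)|%:R != 0 :> F by rewrite card_Sn.
have [eps [epsJ epsC epsc]] := quasi_primitive_idem card0 (c_prim T) c1.
by rewrite (sym_idem_eq epsJ epsC epsc).
Qed.

Lemma sym_idem_ortho mu nu : mu <> nu -> sym_idem F mu * sym_idem F nu = 0.
Proof.
have ortho (m1 m2 : intpart n) (T1 : tableau m1) (T2 : tableau m2) :
    (forall a, young_sym F T1 * a * young_sym F T2 = 0) ->
    sym_idem F m1 * sym_idem F m2 = 0.
  move=> c12; have [e1J _ _] := sym_idemP T1; have [e2J _ _] := sym_idemP T2.
  apply/eqP; rewrite -memv0.
  have -> : sym_idem F m1 * sym_idem F m2 = amulr (sym_idem F m2) (sym_idem F m1).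
    by rewrite lfunE.
  apply: ideal_line_ind e1J => a b; rewrite lfunE /=.
  have -> : a * young_sym F T1 * b * sym_idem F m2
      = amull (a * young_sym F T1 * b) (sym_idem F m2) by rewrite lfunE.
  apply: ideal_line_ind e2J => a' b'; rewrite lfunE /=.
  have -> : a * young_sym F T1 * b * (a' * young_sym F T2 * b')
      = a * (young_sym F T1 * (b * a') * young_sym F T2) * b' by rewrite !mulrA.
  by rewrite c12 mulr0 mul0r mem0v.
move=> neq; have [T _] := exists_tableau mu; have [S _] := exists_tableau nu.
(* Only one order is known to vanish; in the second case centrality exchanges the factors. *)
have [c12|c21] := young_sym_ortho two_neq0 neq; first exact: (ortho _ _ T S).
have [_ epsC _] := sym_idemP T; rewrite epsC; exact: (ortho _ _ S T).
Qed.

(* With C = col_sum T, R = row_sum T and y = (1 - eps) R C one has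
   y a y = (1 - eps) R (C a' R) C, and C a' R is a multiple of C R, which
   1 - eps annihilates. *)
Lemma row_col_sum_mem mu (T : tableau mu) : row_sum F T * col_sum F T \in J T.
Proof.
have [epsJ epsC epsc] := sym_idemP T; set eps := sym_idem F mu in epsJ epsC epsc.
set R := row_sum F T; set C := col_sum F T.
suff y0 : (1 - eps) * (R * C) = 0.
  have -> : R * C = eps * (R * C).
    by apply/eqP; rewrite -subr_eq0 -{1}[R * C]mul1r -mulrBl y0.
  rewrite epsC; have /and3P[_ AJ _] := ideal_line (young_sym F T).
  by rewrite (subvP AJ) // memv_mul ?memvf.
apply: ASP => a.
have f_central x : (1 - eps) * x = x * (1 - eps).
  by rewrite mulrBl mulrBr mul1r mulr1 epsC.
have /vlineP[u cu] := col_row_sum_line two_neq0 T a.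
have -> : (1 - eps) * (R * C) * a * ((1 - eps) * (R * C))
    = R * (1 - eps) * (C * a * R) * (1 - eps) * C.
  have -> : (1 - eps) * (R * C) * a * ((1 - eps) * (R * C))
    = (1 - eps) * R * C * a * ((1 - eps) * R) * C by rewrite !mulrA.
  by rewrite f_central !mulrA.
rewrite cu -scalerAr -!scalerAl -(mulrA _ _ (1 - eps)) -f_central.
by rewrite mulrBl mul1r epsc subrr mulr0 mul0r scaler0.
Qed.

(** The twist moves the signs from columns to rows and sends C R to X = R' C' of the transposed
    tableau, which lies in [J T'] by [row_col_sum_mem]. The twisted idempotent is central and fixes
    X, and X generates [J T'], so it is the identity there. *)
Lemma sign_twist_sym_idem mu :
  sign_twist (sym_idem F mu) = sym_idem F (conj_intpart mu).
Proof.
have [T _] := exists_tableau mu; have [T' T'E] := transpose_tableau T.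
have [epsJ epsC epsc] := sym_idemP T; set eps := sym_idem F mu in epsJ epsC epsc *.
pose X := row_sum F T' * col_sum F T'.
have twist_c : sign_twist (young_sym F T) = X.
  rewrite sign_twistM; congr (_ * _).
    rewrite linear_sum /=; apply: eq_big => [q|q _].
      by apply/col_stabP/row_stabP => qC x; have := qC x;
        rewrite ?(proj1 (T'E _)) -?(proj1 (T'E _)).
    by rewrite linearZ /= sign_twist_gelt scalerA -signr_addb addbb scale1r.
  rewrite linear_sum /=; apply: eq_big => [q|q _]; last exact: sign_twist_gelt.
  by apply/row_stabP/col_stabP => qC x; have := qC x;
    rewrite ?(proj2 (T'E _)) -?(proj2 (T'E _)).
have XJ : X \in J T' := row_col_sum_mem T'.
have twistC x : sign_twist eps * x = x * sign_twist eps.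
  by rewrite -[x]sign_twistK -!sign_twistM epsC.
have X0 : X != 0.
  rewrite -twist_c; apply: contraNneq (c_prim T).1 => c0.
  by rewrite -[young_sym F T]sign_twistK c0 linear0.
apply/esym/(@sym_idem_eq _ T') => //.
  have -> : sign_twist eps = linfun (@sign_twist F n) eps by rewrite lfunE.
  apply: ideal_line_ind epsJ => a b; rewrite lfunE /= sign_twistM (sign_twistM a) twist_c.
  have /and3P[_ AJ JA] := ideal_line (young_sym F T').
  apply: (subvP JA); apply: memv_mul; last exact: memvf.
  by apply: (subvP AJ); apply: memv_mul; first exact: memvf.
have [a [b aXb]] := quasi_primitive_ideal ASP (c_prim T') XJ X0.
have epsX : sign_twist eps * X = X by rewrite -twist_c -sign_twistM epsc.
have assoc (u v w z : A) : u * (v * w * z) = u * v * w * z by rewrite !mulrA.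
by rewrite -aXb assoc (twistC a) -(mulrA a _ X) epsX.
Qed.

Lemma conj_intpartK mu : conj_intpart (conj_intpart mu) = mu.
Proof.
apply: intpart_eq => i; apply/eqP; rewrite eqn_leq; apply/andP; split;
  rewrite leqNgt; apply/negP.
  by move=> lt; move: (lt); rewrite 2!conj_intpartP ltnn.
by move=> lt; move: (lt); rewrite -2!conj_intpartP ltnn.
Qed.

Theorem alt_component_trace mu : mu <> conj_intpart mu ->
  let e := sym_idem F mu + sym_idem F (conj_intpart mu) in
  centrally_primitive (alt_alg F n) e
  /\ alt_component F (pred2 mu (conj_intpart mu)) = (alt_alg F n * <[e]>)%VS.
Proof.
move=> neq e.
(* For n at most 1 every partition is self-conjugate; so n > 1, and 2 is nonzero in F. *)
have n_gt1 : (1 < n)%N.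
  rewrite ltnNge; apply/negP => n1; case: neq; apply: intpart_eq => i.
  have i0 : i = 0%N :> nat by apply/eqP; rewrite -leqn0 -ltnS (leq_trans (ltn_ord i)).
  have := conj_intpartP mu 0 0; rewrite i0.
  have le1 (m : intpart n) : (nth 0 m 0 <= 1)%N := leq_trans (nth_intpart_le m 0) n1.
  by case: (nth 0%N mu 0) (le1 mu) => [|[]] //;
    case: (nth 0%N (conj_intpart mu) 0) (le1 (conj_intpart mu)) => [|[]].
pose tau : 'End(A) := linfun (@sign_twist F n).
have tauE x : tau x = sign_twist x by rewrite lfunE.
have tauM : {morph tau : x y / x * y} by move=> x y; rewrite !tauE sign_twistM.
have tauK : involutive tau by move=> x; rewrite !tauE sign_twistK.
have BP x : reflect (tau x = x) (x \in alt_alg F n).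
  by rewrite tauE; apply: alt_algP; apply: two_neq0.
have comp nu (T : tableau nu) : nu <> conj_intpart nu ->
    let e := sym_idem F nu + tau (sym_idem F nu) in
    [/\ centrally_primitive (alt_alg F n) e,
        component_of (alt_alg F n) (sym_alg F n * <[young_idem F T]>)%VS
          (alt_alg F n * <[e]>)%VS
      & forall I, component_of (alt_alg F n) (sym_alg F n * <[young_idem F T]>)%VS I ->
          I = (alt_alg F n * <[e]>)%VS].
  move=> nu_neq; have [epsJ epsC epsc] := sym_idemP T.
  have ortho : sym_idem F nu * tau (sym_idem F nu) = 0.
    by rewrite tauE sign_twist_sym_idem sym_idem_ortho.
  rewrite young_idem_line; split.
  - exact: (centrally_primitive_trace ASP tauM tauK BP (c_prim T)).
  - exact: (component_of_trace ASP tauM tauK BP (c_prim T)).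
  - exact: (component_of_trace_unique ASP tauM tauK BP (c_prim T)).
have eE : e = sym_idem F mu + tau (sym_idem F mu) by rewrite tauE sign_twist_sym_idem.
(* [alt_component] quantifies over both shapes of gamma, and e is the trace of either idempotent. *)
have eE' : e = sym_idem F (conj_intpart mu) + tau (sym_idem F (conj_intpart mu)).
  by rewrite tauE sign_twist_sym_idem conj_intpartK addrC.
have neq' : conj_intpart mu <> conj_intpart (conj_intpart mu).
  by rewrite conj_intpartK => /esym.
have [T _] := exists_tableau mu; split.
  by rewrite eE; have [] := comp _ T neq.
apply: classical_sets.xget_unique.
  move=> nu /pred2P[]-> S; first by rewrite eE; have [] := comp _ S neq.
  by rewrite eE'; have [] := comp _ S neq'.
move=> I /(_ mu (predU1l _ erefl) T); rewrite eE.
by have [_ _] := comp _ T neq; apply.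
Qed.

End Components.

Theorem theorem3p3 (F : finFieldType) (p n : nat) (hp : p \in [pchar F])
    (hn : (0 < n)%N) (hpn : (n < p)%N) (lambda : intpart n)
    (hlambda : lambda <> conj_intpart lambda) :
  let lambda' := conj_intpart lambda in
  let gamma := pred2 lambda lambda' in
  let e := sym_idem F lambda + sym_idem F lambda' in
  centrally_primitive (alt_alg F n) e
  /\ alt_component F gamma = (alt_alg F n * <[e]>)%VS.
Proof.
have fact_neq0 : n`!%:R != 0 :> F.
  rewrite -(dvdn_pcharf hp); elim: n hpn {hn lambda hlambda} => [|m IH] mp.
    by rewrite dvdn1 neq_ltn prime_gt1 ?orbT ?(pcharf_prime hp).
  rewrite factS (Euclid_dvdM _ _ (pcharf_prime hp)) negb_or IH 1?ltnW // andbT.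
  by rewrite gtnNdvd.
have two_neq0 : (1 < n)%N -> 2%:R != 0 :> F by move=> n1; apply: (natr_neq0 fact_neq0).
apply: alt_component_trace => // mu; exact: num_standard_neq0.
Qed.
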